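(* Let $\mathfrak{M}=\mathbf{m}_1^{k_1}\cdots\mathbf{m}_r^{k_r}$ be a factorization structure of degree $\mathbf{m}$. Then $\mathscr{F}^{\mathfrak{M}}$ is a complex analytic manifold in $\mathbb{P}^{\mathbf{m}}$ and $$\mathrm{codim}(\mathscr{F}^{\mathfrak{M}})=\langle\mathbf{m}\rangle-\big(\langle\mathbf{m}_1\rangle+\cdots+\langle\mathbf{m}_r\rangle+1-r\big).$$
   Context: For nonzero $f\in\mathbb{C}[x_1,\ldots,x_\ell]$, $\deg(f)=(\deg_{x_1}f,\ldots,\deg_{x_\ell}f)$. $\mathbb{P}^{\mathbf{n}}$ is the vector space of polynomials of degree $\le\mathbf{n}$ (componentwise), $\langle\mathbf{n}\rangle=\dim\mathbb{P}^{\mathbf{n}}$, and $\mathscr{P}^{\mathbf{n}}$ is the set of polynomials of degree exactly $\mathbf{n}$. $[\![f]\!]\in\mathbb{C}^{\langle\mathbf{n}\rangle}$ is the coefficient vector of $f\in\mathbb{P}^{\mathbf{n}}$ in the monomial basis, $[\![S]\!]=\{[\![p]\!]:p\in S\}$, and $\mathbb{P}^{\mathbf{n}}$ is topologized by $\|f\|=\|[\![f]\!]\|_2$. If $f$ has degree $\mathbf{m}$ and $f=\alpha f_1^{k_1}\cdots f_r^{k_r}$ with $\alpha\in\mathbb{C}\setminus\{0\}$, $f_j$ irreducible and pairwise coprime, $k_j\ge1$, $\mathbf{m}_j=\deg(f_j)$, then the factorization structure of $f$ is the formal product $\mathfrak{M}=\mathbf{m}_1^{k_1}\cdots\mathbf{m}_r^{k_r}$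 (order irrelevant; the same $\mathbf{m}_j$ may occur more than once). A factorization structure of degree $\mathbf{m}$ is the factorization structure of some polynomial of degree $\mathbf{m}=k_1\mathbf{m}_1+\cdots+k_r\mathbf{m}_r$. The set $\mathscr{F}^{\mathfrak{M}}$ consists of all $f\in\mathscr{P}^{\mathbf{m}}$ of the form $f=\alpha g_1^{k_1}\cdots g_r^{k_r}$ with $\alpha\in\mathbb{C}$ and $g_j\in\mathscr{P}^{\mathbf{m}_j}$ irreducible and pairwise coprime. A subset $S\subset\mathbb{P}^{\mathbf{m}}$ is a complex analytic manifold of dimension $k$ in $\mathbb{P}^{\mathbf{m}}$ if for every $p\in S$ there are an open subset $\Omega$ of $\mathbb{P}^{\mathbf{m}}$ containing $p$ and a biholomorphic mapping from $[\![S\cap\Omega]\!]\subset\mathbb{C}^{\langle\mathbf{m}\rangle}$ onto an open subset of $\mathbb{C}^k$ (a bijection that is locally the restriction of a holomorphic map on an open set, with holomorphic inverse). Its codimension is $\mathrm{codim}(S)=\langle\mathbf{m}\rangle-k$. *)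

(* Defs.v *)
From HB Require Import structures.
From mathcomp Require Import all_boot all_order all_algebra.
From mathcomp Require Import complex.
From mathcomp Require mpoly.

Set Implicit Arguments.
Unset Strict Implicit.
Unset Printing Implicit Defensive.

Import Order.TTheory GRing.Theory Num.Theory.

Local Open Scope ring_scope.

(* The notations of mpoly clash with those of mathcomp.analysis: they are imported
   inside this module only, before mathcomp.analysis is loaded. *)
Module MultiPoly.
Import mpoly.

Section Irreducibility.
Variables (K : fieldType) (l : nat).
Implicit Types f g h : {mpoly K[l]}.

(* The units of {mpoly K[l]} are the nonzero constants. *)
Definition irreducible_mpoly f : Prop :=
  [/\ f != 0, f \isn't a GRing.unit &
      forall g h, f = g * h -> g \is a GRing.unit \/ h \is a GRing.unit].

Definition coprime_mpoly f g : Prop :=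
  forall h, (exists f', f = h * f') -> (exists g', g = h * g') ->
  h \is a GRing.unit.

End Irreducibility.

Section Multidegree.
Variables (K : fieldType) (l : nat).
Implicit Types (f : {mpoly K[l]}) (n : 'X_{1..l}).

Definition degX (i : 'I_l) f : nat := (\max_(a <- msupp f) a i)%N.

(* The junk value for f = 0 is 0. *)
Definition multideg f : 'X_{1..l} := [multinom degX i f | i < l].

(* P^n, including the zero polynomial *)
Definition in_polys n f : Prop := (multideg f <= n)%MM.

Definition in_polys_exact n f : Prop := f != 0 /\ multideg f = n.

(* The exponents of the monomials in P^n. The bound (mdeg n).+1 on the total
   degree, implied by a <= n, only serves to range over a finite type. *)
Definition expos n : {set 'X_{1..l < (mdeg n).+1}} :=
  [set a : 'X_{1..l < (mdeg n).+1} | (bmnm a <= n)%MM].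

(* dim P^n; see coefvec_inj and coefvec_surj below. *)
Definition dimP n : nat := #|expos n|.

Definition coefvec n f : 'rV[K]_(dimP n) :=
  \row_i f@_(bmnm (enum_val i)).

Lemma in_polysP n f :
  in_polys n f <-> {in msupp f, forall a, (a <= n)%MM}.
Proof.
split=> [/mnm_lepP le_n a a_f|le_n].
  apply/mnm_lepP => i; apply: leq_trans (le_n i).
  rewrite mnmE /degX; exact: leq_bigmax_seq a_f isT.
apply/mnm_lepP => i; rewrite mnmE; apply/bigmax_leqP_seq => a a_f _.
by have /mnm_lepP := le_n a a_f.
Qed.

Lemma coefvec_linear n : linear (coefvec n).
Proof. by move=> c f g; apply/rowP => i; rewrite !mxE linearP. Qed.

Lemma expos_mem n (a : 'X_{1..l}) :
  (a <= n)%MM -> exists2 b, b \in expos n & bmnm b = a.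
Proof.
move=> le_an.
have lt_a : (mdeg a < (mdeg n).+1)%N by rewrite ltnS !mdegE leq_sum// => i _;
  have /mnm_lepP := le_an.
by exists (BMultinom lt_a); rewrite ?inE.
Qed.

Lemma coefvec_inj n f g :
  in_polys n f -> in_polys n g -> coefvec n f = coefvec n g -> f = g.
Proof.
move=> /in_polysP nf /in_polysP ng /rowP eq_fg; apply/mpolyP => a.
case: (boolP (a <= n)%MM) => [/expos_mem[b bn <-]|nan].
  by have := eq_fg (enum_rank_in bn b); rewrite !mxE enum_rankK_in.
have out h : {in msupp h, forall b, (b <= n)%MM} -> h@_a = 0.
  by move=> nh; apply: memN_msupp_eq0; apply: contra nan => /nh.
by rewrite !out.
Qed.

Lemma coefvec_surj n (v : 'rV[K]_(dimP n)) :
  exists2 f, in_polys n f & coefvec n f = v.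
Proof.
pose f : {mpoly K[l]} := \sum_i v 0 i *: 'X_[bmnm (enum_val i)].
have fE a : f@_a = \sum_i v 0 i * (bmnm (enum_val i) == a)%:R.
  by rewrite raddf_sum; apply: eq_bigr => i _; rewrite /= mcoeffZ mcoeffX.
exists f.
  apply/in_polysP => a; rewrite mcoeff_msupp fE; apply: contraNT => nan.
  rewrite big1// => i _; case: eqP => [ea|]; last by rewrite mulr0.
  by case/negP: nan; rewrite -ea; have := enum_valP i; rewrite inE.
apply/rowP => j; rewrite mxE fE (bigD1 j)//= eqxx mulr1 big1 ?addr0// => i ij.
case: eqP => [/val_inj/enum_val_inj e|]; last by rewrite mulr0.
by rewrite e eqxx in ij.
Qed.

End Multidegree.

Section FactorizationStructure.
Variables (K : fieldType) (l r : nat).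
Implicit Types (f : {mpoly K[l]}) (m : 'X_{1..l}).
Implicit Types (md : 'I_r -> 'X_{1..l}) (k : 'I_r -> nat).

(* The formal product md_1^k_1 ... md_r^k_r is represented by the families md
   and k; r = 0 is the structure of the nonzero constants. *)
Definition has_fact_structure f md k : Prop :=
  exists (alpha : K) (g : 'I_r -> {mpoly K[l]}),
    [/\ alpha != 0,
        forall j, irreducible_mpoly (g j),
        forall i j, i != j -> coprime_mpoly (g i) (g j),
        forall j, (0 < k j)%N /\ multideg (g j) = md j &
        f = alpha *: \prod_j g j ^+ k j].

Definition fact_structure m md k : Prop :=
  exists f, in_polys_exact m f /\ has_fact_structure f md k.

Definition fact_set m md k : {mpoly K[l]} -> Prop := fun f =>
  in_polys_exact m f /\
  exists (alpha : K) (g : 'I_r -> {mpoly K[l]}),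
    [/\ forall j, in_polys_exact (md j) (g j),
        forall j, irreducible_mpoly (g j),
        forall i j, i != j -> coprime_mpoly (g i) (g j) &
        f = alpha *: \prod_j g j ^+ k j].

End FactorizationStructure.

Arguments fact_structure K {l r} m md k.
Arguments fact_set K {l r} m md k _.

End MultiPoly.

Notation multinom := mpoly.multinom.
Notation mpoly := mpoly.mpoly.
(* Instances and coercions only: the notations stay hidden. *)
Export (canonicals, coercions) mpoly.
Export MultiPoly.

From mathcomp Require Import all_classical all_reals all_analysis.
Import numFieldNormedType.Exports.
Local Open Scope classical_set_scope.

(* Typing R[i] as a numClosedFieldType lets inference find the topology and norm
   that mathcomp.analysis attaches to an arbitrary numFieldType. *)
Definition C (R : realType) : numClosedFieldType := R[i].

Section Manifold.
Variable R : realType.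
Local Notation C := (C R).

(* Differentiability is relative to the scalar field C: the differential is
   C-linear. *)
Definition holomorphic_on (p q : nat) (U : set 'rV[C]_p)
    (f : 'rV[C]_p -> 'rV[C]_q) : Prop :=
  open U /\ forall x, U x -> differentiable f x.

(* A is not open in general, so holomorphy of phi on A means local extendability
   to a holomorphic map on an open set. *)
Definition biholomorphic (p q : nat) (A : set 'rV[C]_p) (V : set 'rV[C]_q)
    (phi : 'rV[C]_p -> 'rV[C]_q) : Prop :=
  [/\ set_bij A V phi,
      forall x, A x -> exists (U : set 'rV[C]_p) (Phi : 'rV[C]_p -> 'rV[C]_q),
        [/\ U x, holomorphic_on U Phi & {in A `&` U, Phi =1 phi}] &
      exists psi : 'rV[C]_q -> 'rV[C]_p,
        holomorphic_on V psi /\ {in A, cancel phi psi}].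

Variable l : nat.
Implicit Types (m : multinom l) (S Omega : set (mpoly l C)).

Definition polynorm m (f : mpoly l C) : C :=
  sqrtC (\sum_i `|coefvec m f 0 i| ^+ 2).

(* The open sets of P^m for the norm polynorm. *)
Definition open_in_polys m Omega : Prop :=
  Omega `<=` in_polys m /\
  forall p, Omega p -> exists2 e : C, 0 < e &
    forall q : mpoly l C, in_polys m q -> polynorm m (q - p) < e -> Omega q.

Definition analytic_manifold_of_dim m S (d : nat) : Prop :=
  S `<=` in_polys m /\
  forall p, S p -> exists Omega (V : set 'rV[C]_d)
      (phi : 'rV[C]_(dimP m) -> 'rV[C]_d),
    [/\ open_in_polys m Omega, Omega p, open V &
        biholomorphic (coefvec m @` (S `&` Omega)) V phi].

Definition analytic_manifold m S : Prop :=
  exists d, analytic_manifold_of_dim m S d.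

(* The dimension is unique if S is a nonempty manifold; the junk value is 0 if S is
   not a manifold. *)
Definition manifold_dim m S : nat := xget 0%N (analytic_manifold_of_dim m S).

Definition codim m S : int := (dimP m)%:Z - (manifold_dim m S)%:Z.

End Manifold.

(* Main.v *)
Require Import Defs.
From HB Require Import structures.
From mathcomp Require Import all_boot all_order all_algebra.
From mathcomp Require Import complex zify ring lra.
From mathcomp Require boolp mpoly.

Set Implicit Arguments.
Unset Strict Implicit.
Unset Printing Implicit Defensive.

Import Order.TTheory GRing.Theory Num.Theory.

Local Open Scope ring_scope.

(** Factorizations are rigid, so that near one of its points the set of the
    theorem looks like the space of normalised factorizations.

    Let [f = alpha * g_1 ^ k_1 * ... * g_r ^ k_r] be a point of this set, with
    [g_j] of degree [m_j]. Constants can be moved between the [g_j] and [alpha];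
    fixing to 1 one coefficient of each [g_j] that does not vanish removes this
    freedom. What remains is [alpha] and the other coefficients of the [g_j], that
    is [1 + sum_j (dim P^m_j - 1)] free parameters, and [f] is the value at some
    [x0] of a polynomial map [slice_product] of these parameters. Three facts make
    this map a local parametrization.

    It is an immersion at [x0] ([slice_immersion]): if its derivative vanishes in
    the direction of variations [a] of [alpha] and [h_j] of [g_j], then every [g_j]
    divides [h_j], because [g_j] is prime and divides none of the other factors.
    As the degree of [h_j] is at most that of [g_j], the quotient is a constant,
    and it is zero because [h_j] has the coefficient 0 where [g_j] has the
    coefficient 1. A holomorphic inverse function theorem then yields a
    holomorphic left inverse on an open set of coefficient vectors
    ([immersion_left_inverse]).

    Its values near [x0] belong to the set ([near_slice_regular]), because for
    polynomials of bounded degree it is an open condition to have the maximal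
    degree, to be irreducible, and to be coprime when irreducible.

    Its values near [x0] contain all the points of the set near [f]
    ([slice_captures]). Factors of norm 1 range over a compact set; hence if
    factorizations of polynomials tending to [f] stayed away from the one above,
    a limit of them would be another expression
    [f = beta * h_1 ^ k_1 * ... * h_r ^ k_r] with [h_j] of degree at most [m_j].
    Counting prime factors shows that there is none: up to constants the [h_j]
    are a permutation of the [g_j] that preserves degrees and multiplicities
    ([factor_match]).

    The last two facts use the same compactness argument ([factor_limit]), and
    all of them use unique factorization in several variables
    ([factorial_mpoly]). The dimension of a nonempty manifold is unique by the
    chain rule ([chart_dim_le]), so that the codimension is given by the number
    of parameters ([slice_dimE]). *)

(** * Unique factorization *)

Section Divisibility.
Variable D : idomainType.
Implicit Types (a b c p q u : D) (s : seq D).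

Definition dvdr a b : Prop := exists c, b = a * c.

Definition prime_elt p : Prop :=
  [/\ p != 0, p \isn't a GRing.unit &
      forall a b, dvdr p (a * b) -> dvdr p a \/ dvdr p b].

Definition irreducible_elt p : Prop :=
  [/\ p != 0, p \isn't a GRing.unit &
      forall a b, p = a * b -> a \is a GRing.unit \/ b \is a GRing.unit].

Lemma dvdr_refl a : dvdr a a.
Proof. by exists 1; rewrite mulr1. Qed.

Lemma dvdr_mulr a b c : dvdr a b -> dvdr a (b * c).
Proof. by case=> d ->; exists (d * c); rewrite mulrA. Qed.

Lemma dvdr_mull a b c : dvdr a b -> dvdr a (c * b).
Proof. by rewrite mulrC; exact: dvdr_mulr. Qed.

Lemma dvdr_trans a b c : dvdr a b -> dvdr b c -> dvdr a c.
Proof. by case=> x -> [y ->]; exists (x * y); rewrite mulrA. Qed.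

Lemma dvdr_unit a b : b \is a GRing.unit -> dvdr a b -> a \is a GRing.unit.
Proof. by move=> ub [c eb]; move: ub; rewrite eb unitrM => /andP[]. Qed.

Lemma dvdr_add a b c : dvdr a b -> dvdr a c -> dvdr a (b + c).
Proof. by move=> [x ->] [y ->]; exists (x + y); rewrite mulrDr. Qed.

Lemma dvdr_opp a b : dvdr a b -> dvdr a (- b).
Proof. by move=> [x ->]; exists (- x); rewrite mulrN. Qed.

Lemma dvdr_addr a b c : dvdr a b -> dvdr a (b + c) -> dvdr a c.
Proof. by move=> ab abc; rewrite -(addKr b c); apply/dvdr_add/abc/dvdr_opp. Qed.

Lemma prime_dvdr_prod p (I : Type) (s : seq I) (P : pred I) (F : I -> D) :
  prime_elt p -> dvdr p (\prod_(i <- s | P i) F i) ->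
  exists2 i, P i & dvdr p (F i).
Proof.
move=> [p0 pu pP]; elim: s => [|i s IH].
  by rewrite big_nil => /(dvdr_unit (unitr1 _)) up; rewrite up in pu.
by rewrite big_cons; case: ifP => // Pi; case/pP => //; exists i.
Qed.

Lemma prime_dvdr_exp p a n : prime_elt p -> dvdr p (a ^+ n) -> dvdr p a.
Proof.
move=> [p0 pu pP]; elim: n => [|n IH].
  by rewrite expr0 => /(dvdr_unit (unitr1 _)) up; rewrite up in pu.
by rewrite exprS; case/pP.
Qed.

Lemma irreducible_dvdr p q : irreducible_elt p -> q \isn't a GRing.unit ->
  dvdr q p -> exists2 u, u \is a GRing.unit & p = q * u.
Proof.
move=> [p0 pu pP] qu [u e]; exists u => //.
by case: (pP _ _ e) => // uq; rewrite uq in qu.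
Qed.

Lemma prime_irreducible p : prime_elt p -> irreducible_elt p.
Proof.
move=> [p0 pu pP]; split=> // a b e.
have key x y : p = x * y -> dvdr p x -> y \is a GRing.unit.
  move=> exy [z ez]; apply/unitrP; exists z.
  suff : p * (z * y) = p * 1 by move/(mulfI p0) => zy; rewrite [y * z]mulrC zy.
  by rewrite mulrA -ez -exy mulr1.
have : dvdr p (a * b) by rewrite -e; exact: dvdr_refl.
case/pP => [/(key _ _ e)|]; first by right.
by rewrite mulrC in e => /(key _ _ e); left.
Qed.

Lemma prime_assoc p u : u \is a GRing.unit -> prime_elt p -> prime_elt (p * u).
Proof.
move=> uu [p0 pu pP].
have dv a : dvdr (p * u) a <-> dvdr p a.
  split=> [[c ->]|[c ->]]; first by exists (u * c); rewrite mulrA.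
  by exists (u^-1 * c); rewrite -mulrA mulVKr.
split; first by rewrite mulf_neq0//; apply: contraTneq uu => ->; rewrite unitr0.
  by rewrite unitrM (negPf pu).
by move=> a b; rewrite !dv; exact: pP.
Qed.

(** Asking for prime rather than irreducible factors includes the uniqueness of
    the factorization. *)
Definition factorial_ring : Prop :=
  forall a, a != 0 -> exists (u : D) (s : seq D),
    [/\ u \is a GRing.unit, forall p, p \in s -> prime_elt p &
        a = u * \prod_(p <- s) p].

Lemma factorial_irreducible p :
  factorial_ring -> irreducible_elt p -> prime_elt p.
Proof.
move=> fD [p0 pu pP]; have [u [s [uu sP e]]] := fD p p0.
case: s => [|q s] in sP e.
  by rewrite e big_nil mulr1 uu in pu.
have qP := sP q (mem_head _ _); move: e; rewrite big_cons mulrCA => e.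
case: (pP _ _ e) => [uq|ur].
  by case: (qP); rewrite uq.
by rewrite e; exact: prime_assoc.
Qed.

Lemma factorial_prime_dvdr a : factorial_ring -> a != 0 ->
  a \isn't a GRing.unit -> exists2 p, prime_elt p & dvdr p a.
Proof.
move=> fD a0 au; have [u [s [uu sP e]]] := fD a a0.
case: s => [|q s] in sP e; first by rewrite e big_nil mulr1 uu in au.
exists q; first exact/sP/mem_head.
by rewrite e big_cons; apply/dvdr_mull/dvdr_mulr/dvdr_refl.
Qed.

End Divisibility.

Section GaussLemma.
Variable D : idomainType.
Implicit Types (a b c : D) (f g h p q : {poly D}).

Lemma dvdr_polyC a f : dvdr a%:P f -> forall i, dvdr a f`_i.
Proof. by move=> [g ->] i; rewrite coefCM; exact/dvdr_mulr/dvdr_refl. Qed.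

(** By induction on the degrees: if a constant prime divides a product, it divides
    one of the leading coefficients, and that leading term can be removed. *)
Lemma prime_polyC a : prime_elt a -> prime_elt a%:P.
Proof.
move=> [a0 au aP]; split; first by rewrite polyC_eq0.
  by rewrite poly_unitE coefC eqxx (negPf au) andbF.
move=> f g; have [n] := ubnP (size f + size g).
elim: n => // n IH in f g *; rewrite ltnS => le_n fg.
have [->|f0] := eqVneq f 0; first by left; exists 0; rewrite mulr0.
have [->|g0] := eqVneq g 0; first by right; exists 0; rewrite mulr0.
have drop_lead h : h != 0 -> dvdr a (lead_coef h) ->
    exists h', [/\ (size h' < size h)%N, dvdr a%:P (h - h') &
                   dvdr a%:P h' -> dvdr a%:P h].
  move=> h0 [c ec]; exists (h - lead_coef h *: 'X^((size h).-1)).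
  have dv : dvdr a%:P (lead_coef h *: 'X^((size h).-1)).
    by exists (c *: 'X^((size h).-1)); rewrite ec mul_polyC scalerA.
  split; last 2 first.
  - by rewrite opprB addrCA subrr addr0.
  - by move=> d1; rewrite -(subrK (lead_coef h *: 'X^((size h).-1)) h); exact: dvdr_add.
  rewrite -{2}(prednK (n := size h)) ?lt0n ?size_poly_eq0//.
  apply/leq_sizeP => i; rewrite leq_eqVlt => /orP[/eqP <-|lt_i].
    by rewrite coefB coefZ coefXn eqxx mulr1 lead_coefE subrr.
  rewrite coefB coefZ coefXn gtn_eqF// mulr0 subr0.
  by apply/leq_sizeP: lt_i; rewrite prednK// lt0n size_poly_eq0.
have : dvdr a (lead_coef f * lead_coef g).
  by rewrite -lead_coefM lead_coefE; exact: dvdr_polyC.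
case/aP => [/(drop_lead _ f0)|/(drop_lead _ g0)] [h [lt_h dh hP]].
- have : dvdr a%:P (h * g).
    apply: (dvdr_addr (b := (f - h) * g)); first exact: dvdr_mulr.
    by rewrite -mulrDl subrK.
  case/IH; first by rewrite (leq_trans _ le_n)// ltn_add2r.
  - by move/hP; left.
  - by right.
- have : dvdr a%:P (f * h).
    apply: (dvdr_addr (b := f * (g - h))); first exact: dvdr_mull.
    by rewrite -mulrDr subrK.
  case/IH; first by rewrite (leq_trans _ le_n)// ltn_add2l.
  - by left.
  - by move/hP; right.
Qed.

Definition primitive f : Prop := forall a, prime_elt a -> ~ dvdr a%:P f.

Hypothesis fD : factorial_ring D.

Lemma primitive_dvdr f g : dvdr f g -> primitive g -> primitive f.
Proof. by move=> fg pg a pa af; exact: pg pa (dvdr_trans af fg). Qed.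

Lemma primitive_polyC a : a != 0 -> primitive a%:P -> a \is a GRing.unit.
Proof.
move=> a0 pa; apply/negPn/negP => ua.
have [q pq [c ec]] := factorial_prime_dvdr fD a0 ua.
by apply: (pa q pq); exists c%:P; rewrite ec polyCM.
Qed.

Lemma primitive_size1 f : f != 0 -> primitive f -> (size f <= 1)%N ->
  f \is a GRing.unit.
Proof.
move=> f0 pf /size1_polyC ef; rewrite ef in f0 pf *.
by apply: rmorph_unit; apply: primitive_polyC => //; rewrite -polyC_eq0.
Qed.

(** Prime constants are split off one by one; this ends because each of them uses
    up a prime factor of the leading coefficient. *)
Lemma primitive_part f : f != 0 ->
  exists2 d, d != 0 & exists2 g, primitive g & f = d%:P * g.
Proof.
move=> f0; have lf0 : lead_coef f != 0 by rewrite lead_coef_eq0.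
have [u [s [uu sP es]]] := fD lf0.
have [n sn] : exists n, size s = n by exists (size s).
elim: n => [|n IH] in f f0 lf0 u uu s sP es sn *; last first.
  have [pf|/boolp.existsNP[a]] := boolp.EM (primitive f).
    by exists 1; rewrite ?oner_eq0//; exists f; rewrite ?mul1r.
  move=> /boolp.not_implyP[pa /boolp.contrapT[f1 ef]].
  have [a0 au aP] := pa.
  have : dvdr a (u * \prod_(p <- s) p).
    by rewrite -es lead_coefE; apply: dvdr_polyC; exists f1.
  case/aP => [/(dvdr_unit uu)|]; first by move: au => /negPf ->.
  rewrite big_seq => /(prime_dvdr_prod pa)[q qs aq].
  have [t ut et] := irreducible_dvdr (prime_irreducible (sP q qs)) au aq.
  have f10 : f1 != 0 by apply: contraNneq f0 => f10; rewrite ef f10 mulr0.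
  have [|||||d d0 [g pg eg]] := IH f1 f10 _ (u * t) _ (rem q s).
  - by rewrite lead_coef_eq0.
  - by rewrite unitrM uu.
  - by move=> p /mem_rem/sP.
  - apply: (mulfI a0); rewrite -(lead_coefC a) -lead_coefM -ef es lead_coefC.
    by rewrite (big_rem q qs)/= et !mulrA [u * a]mulrC.
  - by rewrite size_rem// sn.
  exists (a * d); first by rewrite mulf_neq0.
  by exists g => //; rewrite polyCM -mulrA -eg.
exists 1; rewrite ?oner_eq0//; exists f; rewrite ?mul1r// => a pa af.
have [a0 /negP au aP] := pa; apply: au.
apply: (dvdr_unit (b := lead_coef f)); last first.
  by rewrite lead_coefE; exact: dvdr_polyC.
by rewrite es; move/size0nil: sn => ->; rewrite big_nil mulr1.
Qed.

(** Gauss's lemma. It turns the divisibility up to constants of the theory of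
    pseudo-division, which sees polynomials over the fraction field, into
    divisibility. *)
Lemma Gauss_dvdr c h p : c != 0 -> primitive h ->
  dvdr h (c%:P * p) -> dvdr h p.
Proof.
move=> c0 ph [g]; have [u [s [uu sP ->]]] := fD c0.
rewrite polyCM -mulrA => e.
have {e} : exists g', (\prod_(p <- s) p)%:P * p = h * g'.
  exists (u^-1%:P * g); rewrite mulrCA -e [RHS]mulrA -polyCM mulVr// mul1r//.
elim: s sP => [|q s IH] sP [g' e]; first by exists g'; rewrite -e big_nil mul1r.
have qP := sP q (mem_head _ _); apply: IH.
  by move=> x xs; apply: sP; rewrite inE xs orbT.
move: e; rewrite big_cons polyCM -mulrA => e.
have [q0 qu qPP] := prime_polyC qP.
have : dvdr q%:P (h * g') by rewrite -e; exact/dvdr_mulr/dvdr_refl.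
case/qPP => [/ph|]; first by [].
by move=> [g'' eg]; exists g''; apply: (mulfI q0); rewrite e eg mulrCA.
Qed.

(** Let [p] divide [f * g]. Over the fraction field either [p] is coprime to [f],
    and divides [g], or their greatest common divisor has positive degree; the
    primitive part of the latter divides the irreducible [p], so that it is
    associated to [p]. *)
Lemma irreducible_primitive_prime p : (1 < size p)%N ->
  irreducible_elt p -> primitive p -> prime_elt p.
Proof.
move=> sp1 irp pp; have [p0 pu pP] := irp; split=> // f g pfg.
have to_dvdp (x y : {poly D}) : dvdr x y -> x %| y.
  by move=> [z ->]; exact: dvdp_mulr.
have of_dvdp (x y : {poly D}) : primitive x -> x %| y -> dvdr x y.
  move=> px /Pdiv.Idomain.dvdpP[[c q]/= c0 e].
  by apply: (Gauss_dvdr c0 px); exists q; rewrite mul_polyC e mulrC.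
have [cop|ncop] := boolP (coprimep p f).
  by right; apply: of_dvdp => //; rewrite -(Gauss_dvdpr _ cop); exact: to_dvdp.
left; have g0 : gcdp p f != 0 by rewrite gcdp_eq0 negb_and p0.
have [d d0 [h ph eh]] := primitive_part g0.
have hP (x : {poly D}) : gcdp p f %| x -> dvdr h x.
  move=> gx; apply: of_dvdp => //; apply: dvdp_trans gx.
  by rewrite eh mulrC; exact: dvdp_mulr.
have hu : h \isn't a GRing.unit.
  apply: contra ncop; rewrite coprimep_def eh size_Cmul// poly_unitE.
  by case/andP.
have [u uu eu] := irreducible_dvdr irp hu (hP _ (dvdp_gcdl p f)).
have [w ->] := hP _ (dvdp_gcdr p f).
by exists (u^-1 * w); rewrite eu -mulrA mulVKr.
Qed.

(** A primitive polynomial is either irreducible, hence prime, or the product of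
    two primitive polynomials of smaller degrees; the content is a product of
    constant primes. *)
Theorem factorial_poly : factorial_ring {poly D}.
Proof.
have prim f : f != 0 -> primitive f -> exists (u : {poly D}) (s : seq {poly D}),
    [/\ u \is a GRing.unit, forall p, p \in s -> prime_elt p &
        f = u * \prod_(p <- s) p].
  have [n] := ubnP (size f); elim: n => // n IH in f *.
  rewrite ltnS => le_n f0 pf.
  have [le1|lt1] := leqP (size f) 1.
    exists f, [::]; rewrite big_nil mulr1; split=> //; exact: primitive_size1.
  have [irf|nirf] := boolp.EM (irreducible_elt f).
    exists 1, [:: f]; rewrite unitr1 big_seq1 mul1r; split=> // p.
    by rewrite inE => /eqP ->; exact: irreducible_primitive_prime.
  have [a [b [e au bu]]] : exists a b : {poly D}, [/\ f = a * b, a \isn't a GRing.unit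
      & b \isn't a GRing.unit].
    apply: boolp.contrapT => H; apply: nirf; split=> //.
      by rewrite poly_unitE gtn_eqF.
    move=> a b e; case: (boolP (a \is a GRing.unit)) => [|au]; first by left.
    case: (boolP (b \is a GRing.unit)) => [|bu]; first by right.
    by case: H; exists a, b.
  have [a0 b0] : a != 0 /\ b != 0.
    by move: f0; rewrite e mulf_eq0 negb_or => /andP.
  have pa : primitive a by apply: primitive_dvdr pf; exists b.
  have pb : primitive b by apply: primitive_dvdr pf; exists a; rewrite mulrC.
  have sa : (1 < size a)%N.
    by rewrite ltnNge; apply: contra au; exact: primitive_size1.
  have sb : (1 < size b)%N.
    by rewrite ltnNge; apply: contra bu; exact: primitive_size1.
  have sf : size f = (size a + size b).-1 by rewrite e size_mul.
  have lta : (size a < n)%N by lia.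
  have ltb : (size b < n)%N by lia.
  have [u [s [uu sP es]]] := IH a lta a0 pa.
  have [v [t [uv tP et]]] := IH b ltb b0 pb.
  exists (u * v), (s ++ t); rewrite unitrM uu uv big_cat /= mulrACA -es -et.
  by split=> // p; rewrite mem_cat => /orP[/sP|/tP].
move=> f f0; have [d d0 [g pg eg]] := primitive_part f0.
have g0 : g != 0 by apply: contraNneq f0 => g0; rewrite eg g0 mulr0.
have [u [s [uu sP es]]] := prim g g0 pg.
have [v [t [uv tP et]]] := fD d0.
exists (v%:P * u), ([seq c%:P | c <- t] ++ s); split.
- by rewrite unitrM uu andbT; exact: rmorph_unit.
- move=> p; rewrite mem_cat => /orP[/mapP[q qt ->]|/sP//].
  exact/prime_polyC/tP.
- by rewrite big_cat big_map /= mulrACA -es eg et polyCM rmorph_prod.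
Qed.

End GaussLemma.

Module MultiPolyFactor.
Import mpoly.

Lemma factorial_transport (A B : idomainType) (phi : {rmorphism A -> B})
    (psi : {rmorphism B -> A}) :
  cancel phi psi -> cancel psi phi -> factorial_ring B -> factorial_ring A.
Proof.
move=> phiK psiK fB a a0.
have pa0 : phi a != 0 by rewrite -(rmorph0 phi) (inj_eq (can_inj phiK)).
have [u [s [uu sP es]]] := fB _ pa0.
exists (psi u), [seq psi p | p <- s]; split; first exact: rmorph_unit.
- move=> _ /mapP[p /sP[p0 pu pP] ->]; split.
  + by rewrite -(rmorph0 psi) (inj_eq (can_inj psiK)).
  + by apply: contra pu => /(rmorph_unit phi); rewrite psiK.
  + have dv x : dvdr p (phi x) -> dvdr (psi p) x.
      by move=> [c ec]; exists (psi c); rewrite -rmorphM -ec phiK.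
    move=> x y [c /(congr1 phi)]; rewrite !rmorphM psiK => e.
    by have [|/dv|/dv] := pP (phi x) (phi y); [exists (phi c)|left|right].
- by rewrite big_map -rmorph_prod -rmorphM -es phiK.
Qed.

Section MpolyFactorial.
Variable K : fieldType.

(** The inverse of [muni], which isolates the last variable. *)
Definition unmuni n : {poly {mpoly K[n]}} -> {mpoly K[n.+1]} :=
  horner_morph (fun x => mulrC 'X_ord_max (@mwiden n K x)).

HB.instance Definition _ n := GRing.RMorphism.on (@unmuni n).

Lemma muniK n : cancel (@muni n K) (@unmuni n).
Proof.
move=> p; rewrite muniE rmorph_sum [RHS]mpolyE; apply: eq_bigr => m _.
rewrite -!mul_polyC !rmorphM rmorphXn /= {1 2}/unmuni horner_morphC.
rewrite horner_morphX -mul_mpolyC rmorphM /= mwidenC -mulrA mul_mpolyC.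
congr (_ *: _); rewrite mwidenX mpolyXn -mpolyXD; congr 'X_[_].
apply/mnmP => i; rewrite mnmDE mulmnE mnm1E.
case: (unliftP ord_max i) => [j ->|->].
  have -> : lift ord_max j = widen_ord (leqnSn n) j.
    by apply: val_inj; rewrite /= /bump leqNgt ltn_ord.
  rewrite mnmwiden_widen mnmE (_ : (ord_max == _) = false) ?addn0//.
  by apply/negbTE; rewrite -val_eqE /= gtn_eqF.
by rewrite mnmwiden_ordmax eqxx mul1n.
Qed.

Lemma unmuniK n : cancel (@unmuni n) (@muni n K).
Proof.
have muniX : muni ('X_ord_max : {mpoly K[n.+1]}) = 'X.
  rewrite muniE msuppX big_seq1 mcoeffX eqxx scale1r mnm1E eqxx.
  rewrite -[RHS]scale1r; congr (_ *: _).
  rewrite -mpolyX0; congr 'X_[_]; apply/mnmP => i; rewrite mnmE mnm1E mnm0E.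
  by apply/eqP; rewrite eqb0 -val_eqE /= gtn_eqF.
have muniXw i : muni ('X_(widen_ord (leqnSn n) i) : {mpoly K[n.+1]}) = ('X_i)%:P.
  rewrite muniE msuppX big_seq1 mcoeffX eqxx scale1r mnm1E.
  rewrite (_ : (_ == ord_max) = false); last first.
    by rewrite -val_eqE /= ltn_eqF.
  rewrite -mul_polyC mulr1; congr ('X_[_])%:P; apply/mnmP => j.
  by rewrite mnmE !mnm1E -val_eqE.
have muniW p : muni (mwiden p : {mpoly K[n.+1]}) = p%:P.
  rewrite [p]mpolyE (raddf_sum (@mwiden _ _)) !raddf_sum; apply: eq_bigr => m _ /=.
  rewrite mwidenZ muniZ -[in RHS]mul_mpolyC polyCM -mul_polyC; congr (_ * _).
  rewrite /mwiden mmapX /mmap1 mpolyXE_id !rmorph_prod.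
  by apply: eq_bigr => i _; rewrite !rmorphXn /= muniXw.
elim/poly_ind => [|p c IH]; first by rewrite !rmorph0.
rewrite !rmorphD !rmorphM /= IH /unmuni horner_morphX horner_morphC muniX.
by congr (_ + _); exact: muniW.
Qed.

Lemma unit_mpolyE n (f : {mpoly K[n]}) :
  (f \is a GRing.unit) = (f == (f@_0)%:MP) && (f@_0 != 0).
Proof. by rewrite -unitfE. Qed.

Theorem factorial_mpoly n : factorial_ring {mpoly K[n]}.
Proof.
elim: n => [|n IH].
  move=> f f0; exists f, [::]; split; rewrite ?big_nil ?mulr1// unit_mpolyE.
  by move: f0; rewrite {1 2}[f]nvar0_mpolyC eqxx mpolyC_eq0.
exact: factorial_transport (@muniK n) (@unmuniK n) (factorial_poly IH).
Qed.

Lemma irreducible_mpoly_prime n (f : {mpoly K[n]}) :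
  irreducible_mpoly f -> prime_elt f.
Proof. exact/factorial_irreducible/factorial_mpoly. Qed.

End MpolyFactorial.

(** * Multidegrees *)

Section Multidegree.
Variables (K : fieldType) (l : nat).
Implicit Types (f g h : {mpoly K[l]}) (n m a b c : 'X_{1..l}).

(** The product of the parts of maximal degree in [i] of two polynomials is nonzero
    and involves no cancellation with the other terms, hence [degXM]. *)
Definition topX (i : 'I_l) f : {mpoly K[l]} :=
  \sum_(a <- msupp f | a i == degX i f) f@_a *: 'X_[a].

Lemma mcoeff_topX i f c :
  (topX i f)@_c = if c i == degX i f then f@_c else 0.
Proof.
rewrite /topX raddf_sum /=.
have [cf|cf] := boolP (c \in msupp f); last first.
  rewrite (memN_msupp_eq0 cf) if_same big_seq_cond big1// => a /andP[af _].
  rewrite mcoeffZ mcoeffX; case: eqP => [ac|]; last by rewrite mulr0.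
  by rewrite ac (negPf cf) in af.
rewrite big_mkcond (bigD1_seq c)//= big1 ?addr0 => [|a ac]; last first.
  by case: ifP => // _; rewrite mcoeffZ mcoeffX (negPf ac) mulr0.
by rewrite mcoeffZ mcoeffX eqxx mulr1.
Qed.

Lemma degX_le i f a : a \in msupp f -> (a i <= degX i f)%N.
Proof. by move=> af; rewrite /degX; exact: leq_bigmax_seq. Qed.

Lemma mcoeff_gt_degX i f a : (degX i f < a i)%N -> f@_a = 0.
Proof.
by move=> lt_a; apply: memN_msupp_eq0; apply: contraL lt_a => /(degX_le i); rewrite -leqNgt.
Qed.

Lemma degX_attained i f : f != 0 -> exists2 a, a \in msupp f & a i = degX i f.
Proof.
rewrite /degX -msupp_eq0 => sf.
case: (msupp f) sf => // a s _.
elim: s a => [|b s IH] a.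
  by exists a; rewrite ?mem_head// big_seq1.
rewrite big_cons; have [c cs <-] := IH b.
have [le_ac|lt_ca] := leqP (a i) (c i).
  by exists c; rewrite // inE cs orbT.
by exists a; rewrite // mem_head.
Qed.

Lemma topX_neq0 i f : f != 0 -> topX i f != 0.
Proof.
move=> /(degX_attained i)[a af ai]; apply: contraTneq af => t0.
by rewrite mcoeff_msupp negbK; have := mcoeff_topX i f a; rewrite t0 mcoeff0 ai eqxx => <-.
Qed.

Lemma degXM i f g : f != 0 -> g != 0 -> degX i (f * g) = (degX i f + degX i g)%N.
Proof.
move=> f0 g0; apply/eqP; rewrite eqn_leq; apply/andP; split.
  apply/bigmax_leqP_seq => a /msuppM_le /allpairsP[[b c]/= [bf cg ->]] _.
  by rewrite mnmDE leq_add// degX_le.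
have fg0 : topX i f * topX i g != 0 by rewrite mulf_neq0// topX_neq0.
have [a] : exists a, a \in msupp (topX i f * topX i g).
  by move: fg0; rewrite -msupp_eq0; case: msupp => // a s _; exists a; exact: mem_head.
move=> a_top.
have top_supp h b : b \in msupp (topX i h) -> b i = degX i h.
  by rewrite mcoeff_msupp mcoeff_topX; case: (b i =P degX i h) => // _; rewrite eqxx.
have ai : a i = (degX i f + degX i g)%N.
  by have /allpairsP[[b c]/= [bf cg ->]] := msuppM_le a_top; rewrite mnmDE (top_supp f)?(top_supp g).
rewrite -ai; apply: degX_le; move: a_top; rewrite !mcoeff_msupp !mcoeffM.
congr (_ != 0); apply: eq_bigr => -[b c]/= /eqP e.
have ebc : (b i + c i = degX i f + degX i g)%N.
  by rewrite -ai; have := congr1 (fun x : 'X_{1..l} => x i) e; rewrite mnmDE => <-.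
rewrite !mcoeff_topX; case: (ltngtP (b i) (degX i f)) => [lt|lt|eb].
- by rewrite (@mcoeff_gt_degX i g c) ?if_same ?mulr0//; lia.
- by rewrite (@mcoeff_gt_degX i f b) ?mul0r//; lia.
- by rewrite (_ : c i == degX i g)//; apply/eqP; lia.
Qed.

Lemma multidegM f g : f != 0 -> g != 0 ->
  multideg (f * g) = (multideg f + multideg g)%MM.
Proof. by move=> f0 g0; apply/mnmP => i; rewrite mnmDE !mnmE degXM. Qed.

Lemma multidegC (c : K) : multideg (c%:MP : {mpoly K[l]}) = 0%MM.
Proof.
apply/mnmP => i; rewrite mnmE /degX msuppC; case: ifP => _.
  by rewrite big_nil mnm0E.
by rewrite big_seq1.
Qed.

Lemma multidegZ (c : K) f : c != 0 -> multideg (c *: f) = multideg f.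
Proof.
move=> c0; have [->|f0] := eqVneq f 0; first by rewrite scaler0.
rewrite -mul_mpolyC multidegM ?mpolyC_eq0// multidegC.
by apply/mnmP => i; rewrite mnmDE mnm0E.
Qed.

Lemma multideg_prod (I : Type) (s : seq I) (F : I -> {mpoly K[l]}) i :
  (forall j, F j != 0) ->
  multideg (\prod_(j <- s) F j) i = (\sum_(j <- s) multideg (F j) i)%N.
Proof.
move=> F0; elim: s => [|j s IH]; first by rewrite !big_nil -mpolyC1 multidegC mnm0E.
rewrite !big_cons multidegM ?mnmDE ?IH//.
by elim: s {IH} => [|j' s IH]; rewrite ?big_nil ?oner_eq0// big_cons mulf_neq0.
Qed.

Lemma multideg_exp f (n : nat) i : f != 0 -> multideg (f ^+ n) i = (n * multideg f i)%N.
Proof.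
move=> f0; elim: n => [|n IH]; first by rewrite expr0 -mpolyC1 multidegC mnm0E.
by rewrite exprS multidegM ?expf_neq0// mnmDE IH mulSn.
Qed.

Lemma multideg_prod_exp r (g : 'I_r -> {mpoly K[l]}) (k : 'I_r -> nat) (c : K) i :
  c != 0 -> (forall j, g j != 0) ->
  multideg (c *: \prod_j g j ^+ k j) i = (\sum_j k j * multideg (g j) i)%N.
Proof.
move=> c0 g0; rewrite multidegZ// multideg_prod => [|j]; last exact: expf_neq0.
by apply: eq_bigr => j _; rewrite multideg_exp.
Qed.

Lemma multideg0_const f : multideg f = 0%MM -> f = (f@_0)%:MP.
Proof.
move=> f0; apply/mpolyP => a; rewrite mcoeffC.
case: eqP => [->|/eqP a0]; first by rewrite mulr1.
rewrite mulr0; apply: memN_msupp_eq0; apply: contra a0 => af.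
apply/eqP/mnmP => i; rewrite mnm0E.
by apply/eqP; rewrite -leqn0 -[leqRHS](mnm0E i) -f0 mnmE degX_le.
Qed.

Lemma unit_multideg0 f : f != 0 -> multideg f = 0%MM -> f \is a GRing.unit.
Proof.
move=> f0 /multideg0_const e; rewrite unit_mpolyE -e eqxx /=.
by apply: contraNneq f0 => c0; rewrite e c0.
Qed.

Lemma multideg_unit f : f \is a GRing.unit -> multideg f = 0%MM.
Proof. by rewrite unit_mpolyE => /andP[/eqP -> _]; rewrite multidegC. Qed.

Lemma in_polysE n f : in_polys n f <-> forall i, (multideg f i <= n i)%N.
Proof. by split=> [/mnm_lepP|/mnm_lepP]. Qed.

Definition vecpoly n (v : 'rV[K]_(dimP n)) : {mpoly K[l]} :=
  \sum_i v 0 i *: 'X_[bmnm (enum_val i)].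

Lemma mcoeff_vecpoly n (v : 'rV[K]_(dimP n)) a :
  (vecpoly v)@_a = \sum_i v 0 i * (bmnm (enum_val i) == a)%:R.
Proof. by rewrite raddf_sum; apply: eq_bigr => i _; rewrite /= mcoeffZ mcoeffX. Qed.

Lemma vecpoly_in n (v : 'rV[K]_(dimP n)) : in_polys n (vecpoly v).
Proof.
apply/in_polysP => a; rewrite mcoeff_msupp mcoeff_vecpoly; apply: contraNT => nan.
rewrite big1// => i _; case: eqP => [ea|]; last by rewrite mulr0.
by case/negP: nan; rewrite -ea; have := enum_valP i; rewrite inE.
Qed.

Lemma vecpolyK n : cancel (@vecpoly n) (@coefvec K l n).
Proof.
move=> v; apply/rowP => j; rewrite mxE mcoeff_vecpoly (bigD1 j)//= eqxx mulr1.
rewrite big1 ?addr0// => i ij.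
case: eqP => [/val_inj/enum_val_inj e|]; last by rewrite mulr0.
by rewrite e eqxx in ij.
Qed.

Lemma coefvecK n f : in_polys n f -> vecpoly (coefvec n f) = f.
Proof.
by move=> nf; apply: (@coefvec_inj _ _ n); rewrite ?vecpolyK//; exact: vecpoly_in.
Qed.

Lemma mcoeff_out n f a : in_polys n f -> ~~ (a <= n)%MM -> f@_a = 0.
Proof.
by move=> /in_polysP nf nan; apply: memN_msupp_eq0; apply: contra nan => /nf.
Qed.

End Multidegree.

(** * Rigidity of factorizations *)

Section UniqueFactorization.
Variables (K : fieldType) (l r : nat).
Implicit Types (g h : 'I_r -> {mpoly K[l]}) (k : 'I_r -> nat).

Lemma coprime_irreducible_Ndvd (f g : {mpoly K[l]}) :
  irreducible_mpoly f -> coprime_mpoly f g -> ~ dvdr f g.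
Proof.
by move=> [_ /negP fu _] cfg fg; apply: fu; apply: cfg => //; exact: dvdr_refl.
Qed.

Lemma prod_exp_Ndvd g k i (P : pred 'I_r) :
  (forall j, irreducible_mpoly (g j)) ->
  (forall i j, i != j -> coprime_mpoly (g i) (g j)) ->
  ~~ P i -> ~ dvdr (g i) (\prod_(j | P j) g j ^+ k j).
Proof.
move=> irg cog Pi /(prime_dvdr_prod (irreducible_mpoly_prime (irg i)))[j Pj].
move/(prime_dvdr_exp (irreducible_mpoly_prime (irg i))).
by apply/coprime_irreducible_Ndvd/cog => //; apply: contraNneq Pi => ->.
Qed.

(** The degrees force each [h j] to be nonconstant, hence divisible by some
    [g (t j)]. By unique factorization [g i] occurs [k i] times on the left, so
    that the [k j] with [t j = i] add up to at most [k i]; as both sides have the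
    same sum over [i], these bounds are equalities. Thus [t] is onto, hence
    bijective, and nothing is left for the cofactors [u j] but constants. *)
Lemma factor_match g h k (md : 'I_r -> 'X_{1..l}) (alpha beta : K) :
  (forall j, irreducible_mpoly (g j)) ->
  (forall i j, i != j -> coprime_mpoly (g i) (g j)) ->
  (forall j, (0 < k j)%N) -> (forall j, multideg (g j) = md j) ->
  (forall j, in_polys (md j) (h j)) -> alpha != 0 ->
  alpha *: \prod_j g j ^+ k j = beta *: \prod_j h j ^+ k j ->
  exists2 s : 'I_r -> 'I_r, injective s & forall j,
    [/\ k (s j) = k j, md (s j) = md j &
        exists2 c : K, c != 0 & h j = c *: g (s j)].
Proof.
move=> irg cog k0 mdg hin al0 e.
have g0 j : g j != 0 by case: (irg j).
have prodg0 : \prod_j g j ^+ k j != 0 by apply/prodf_neq0 => j _; exact: expf_neq0.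
have : alpha *: \prod_j g j ^+ k j != 0 by rewrite scaler_eq0 negb_or al0.
rewrite e scaler_eq0 negb_or => /andP[be0 /prodf_neq0 hk0].
have h0 j : h j != 0 by have := hk0 j isT; rewrite expf_eq0 k0.
have hle j i : (multideg (h j) i <= md j i)%N by have /in_polysE := hin j.
(* The degrees of the [h j] add up with the weights [k j] to that of the product,
   which is also the sum of their upper bounds. *)
have mdh j : multideg (h j) = md j.
  apply/mnmP => i.
  have := congr1 (fun f => multideg f i) e.
  rewrite /= !multideg_prod_exp// (bigD1 j)//= [in RHS](bigD1 j)//= mdg.
  have : (\sum_(i0 | i0 != j) k i0 * multideg (h i0) i <=
          \sum_(i0 | i0 != j) k i0 * multideg (g i0) i)%N.
    by apply: leq_sum => j' _; rewrite leq_mul2l mdg hle orbT.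
  move=> le_s es; have := hle j i; have := k0 j; move: le_s es.
  set a := (\sum_(_ | _) _)%N; set b := (\sum_(_ | _) _)%N.
  by move=> *; nia.
have hu j : h j \isn't a GRing.unit.
  apply/negP => /multideg_unit h1; have [_ /negP gu _] := irg j; apply: gu.
  by apply: unit_multideg0; rewrite // mdg -mdh.
have [t tP] : exists t : 'I_r -> 'I_r, forall j, exists u, h j = g (t j) * u.
  apply: (fin_all_exists (P := fun j i => exists u, h j = g i * u)) => j.
  have [q qP [w ew]] := factorial_prime_dvdr (@factorial_mpoly K l) (h0 j) (hu j).
  have : dvdr q (alpha *: \prod_j g j ^+ k j).
    rewrite e (bigD1 j)//= -mul_mpolyC; apply/dvdr_mull/dvdr_mulr.
    by rewrite ew -(prednK (k0 j)) exprS; apply/dvdr_mulr/dvdr_mulr/dvdr_refl.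
  rewrite -mul_mpolyC; case: (qP) => q0 qu qM /qM[|].
    move/dvdr_unit; rewrite rmorph_unit ?unitfE// => /(_ isT) uq.
    by rewrite uq in qu.
  move/(prime_dvdr_prod qP) => [i _ /(prime_dvdr_exp qP) qg]; exists i.
  have [u uu ->] := irreducible_dvdr (irg i) qu qg.
  by exists (u^-1 * w); rewrite ew -mulrA mulVKr.
have [u uP] := fin_all_exists tP.
(* The number of factors [g i] that the [h j] are known to contain. *)
pose N i := (\sum_(j | t j == i) k j)%N.
have prodt : \prod_j g (t j) ^+ k j = \prod_i g i ^+ N i.
  rewrite (partition_big t xpredT)//=; apply: eq_bigr => i _.
  by rewrite -prodrXr; apply: eq_bigr => j /eqP ->.
have prodh : \prod_j h j ^+ k j = \prod_i g i ^+ N i * \prod_j u j ^+ k j.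
  by rewrite -prodt -big_split; apply: eq_bigr => j _; rewrite uP exprMn.
have leN i : (N i <= k i)%N.
  rewrite leqNgt; apply/negP => lt_k.
  apply: (@prod_exp_Ndvd g k i (predC1 i) irg cog); first by rewrite /= eqxx.
  move: e; rewrite prodh -!mul_mpolyC (bigD1 i)//= [in RHS](bigD1 i)//=.
  rewrite -(subnK (ltnW lt_k)) exprD => e.
  have {e} : (g i ^+ k i) * (alpha%:MP * \prod_(j | j != i) g j ^+ k j) =
     (g i ^+ k i) * (g i ^+ (N i - k i) * (beta%:MP *
        ((\prod_(j | j != i) g j ^+ N j) * \prod_j u j ^+ k j))).
    by rewrite mulrCA e; ring.
  move/(mulfI (expf_neq0 _ (g0 i))) => e.
  have : dvdr (g i) (alpha%:MP * \prod_(j | j != i) g j ^+ k j).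
    rewrite e -(@prednK (N i - k i)) ?subn_gt0// exprS.
    exact/dvdr_mulr/dvdr_mulr/dvdr_refl.
  have [gi0 giu giM] := irreducible_mpoly_prime (irg i).
  case/giM => // /dvdr_unit; rewrite rmorph_unit ?unitfE// => /(_ isT) ug.
  by rewrite ug in giu.
have sumN : (\sum_i N i = \sum_i k i)%N by rewrite [RHS](partition_big t xpredT).
have Nk i : N i = k i.
  apply/eqP; rewrite eqn_leq leN /=.
  have : (\sum_(j | j != i) N j <= \sum_(j | j != i) k j)%N.
    by apply: leq_sum => j _; exact: leN.
  move: sumN; rewrite (bigD1 i)//= [in RHS](bigD1 i)//=; lia.
have [s sP] : exists s : 'I_r -> 'I_r, forall i, t (s i) = i.
  apply: (fin_all_exists (P := fun i j => t j = i)) => i; apply: boolp.contrapT => H.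
  have := k0 i; rewrite -Nk /N big1// => j /eqP tj; case: H; by exists j.
have s_inj : injective s by move=> i j /(congr1 t); rewrite !sP.
have [s' s'K sK'] := injF_bij s_inj.
have t_inj : injective t.
  by move=> i j; rewrite -(sK' i) -(sK' j) !sP => ->.
have mdu j i : multideg (h j) i = (multideg (g (t j)) i + multideg (u j) i)%N.
  rewrite uP multidegM ?mnmDE//.
  by apply: contraNneq (h0 j) => u0; rewrite uP u0 mulr0.
have u1 j : multideg (u j) = 0%MM.
  apply/mnmP => i; rewrite mnm0E; apply/eqP.
  have : (\sum_j multideg (h j) i = \sum_j multideg (g (t j)) i +
          \sum_j multideg (u j) i)%N.
    by rewrite -big_split; apply: eq_bigr => j' _; exact: mdu.
  rewrite (eq_bigr (fun j => multideg (g j) i)) => [|j' _]; last by rewrite mdh mdg.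
  rewrite (reindex_inj t_inj)/= => /esym/eqP.
  by rewrite -[eqbRHS]addn0 eqn_add2l sum_nat_eq0 => /forallP/(_ j).
exists t => // j; split.
- by rewrite -[LHS]Nk /N (big_pred1 j)// => j'; rewrite /= (inj_eq t_inj).
- by rewrite -mdg -mdh; apply/mnmP => i; rewrite mdu u1 mnm0E addn0.
exists (u j)@_0; first apply: contraNneq (h0 j) => u0.
  by rewrite uP (multideg0_const (u1 j)) u0 mpolyC0 mulr0.
by rewrite uP {1}(multideg0_const (u1 j)) mulrC mul_mpolyC.
Qed.

Lemma coef1M (A : nzRingType) (p q : {poly A}) :
  (p * q)`_1 = p`_0 * q`_1 + p`_1 * q`_0.
Proof. by rewrite coefM !big_ord_recl big_ord0 addr0. Qed.

Lemma coef0_exp (A : comNzRingType) (p : {poly A}) n : (p ^+ n)`_0 = p`_0 ^+ n.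
Proof. exact: (rmorphXn (coefp 0)). Qed.

Lemma coef0_prod (A : comNzRingType) (I : Type) (s : seq I) (P : pred I)
    (F : I -> {poly A}) :
  (\prod_(i <- s | P i) F i)`_0 = \prod_(i <- s | P i) (F i)`_0.
Proof. exact: (rmorph_prod (coefp 0)). Qed.

Lemma coef1_exp (A : comNzRingType) (p : {poly A}) n :
  (p ^+ n)`_1 = p`_0 ^+ n.-1 * p`_1 *+ n.
Proof.
case: n => [|n]; first by rewrite expr0 coef1.
elim: n => [|n IH]; first by rewrite expr1 expr0 mul1r.
rewrite exprS coef1M IH coef0_exp !exprS.
ring.
Qed.

(** A family of polynomials with value [p] and derivative [q] is encoded by the dual
    number [p + q * 'X], of which only the coefficients of degree 0 and 1 matter:
    products of families then become products of dual numbers. The lemma is the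
    injectivity of the derivative of the product map on the variations [h] whose
    coefficients at the monomials [b] vanish. *)
Lemma dual_kernel (g h : 'I_r -> {mpoly K[l]}) (k : 'I_r -> nat)
    (b : 'I_r -> 'X_{1..l}) (alpha a : K) :
  [pchar K] =i pred0 ->
  (forall j, irreducible_mpoly (g j)) ->
  (forall i j, i != j -> coprime_mpoly (g i) (g j)) ->
  (forall j, (0 < k j)%N) -> alpha != 0 ->
  (forall j, in_polys (multideg (g j)) (h j)) ->
  (forall j, (g j)@_(b j) != 0) -> (forall j, (h j)@_(b j) = 0) ->
  ((alpha%:MP%:P + a%:MP%:P * 'X) *
     \prod_j ((g j)%:P + (h j)%:P * 'X) ^+ k j)`_1 = 0 ->
  a = 0 /\ forall j, h j = 0.
Proof.
move=> K0 irg cog k0 al0 hin gb hb e.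
have c0 (x y : {mpoly K[l]}) : (x%:P + y%:P * 'X)`_0 = x.
  by rewrite coefD coefC coefMX addr0.
have c1 (x y : {mpoly K[l]}) : (x%:P + y%:P * 'X)`_1 = y.
  by rewrite coefD coefC coefMX coefC add0r.
have g0 j : g j != 0 by case: (irg j).
have h0 j : h j = 0.
  apply/eqP/negPn/negP => hj0.
  (* Only the factor [j] is developed: the product is [B * G ^ k j] with
     [G = g j + h j * 'X], of derivative [B_1 g ^ k + B_0 k g ^ (k - 1) h], where
     the prime [g] does not divide [B_0]. *)
  move: e; rewrite (bigD1 j)//= mulrCA coef1M coef1_exp.
  rewrite coef0_exp !c0 c1 coef0M c0 coef0_prod.
  set A := nth _ _ 1%N.
  under eq_bigr do rewrite coef0_exp c0.
  set w := \prod_(_ | _) _.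
  rewrite -{1}(prednK (k0 j)) exprS.
  move=> e.
  have {e} : g j ^+ (k j).-1 * (g j * A + alpha%:MP * (w * (h j *+ k j))) = 0.
    by rewrite -[RHS]e -mulrnAr; ring.
  move/eqP; rewrite mulf_eq0 expf_eq0 (negPf (g0 j)) andbF /=.
  rewrite addrC addr_eq0 => /eqP e.
  have gP := irreducible_mpoly_prime (irg j).
  have : dvdr (g j) (alpha%:MP * (w * (h j *+ k j))).
    by rewrite e; apply/dvdr_opp/dvdr_mulr/dvdr_refl.
  have [_ gu gM] := gP.
  case/gM => [/dvdr_unit|].
    by rewrite rmorph_unit ?unitfE// => /(_ isT) ug; rewrite ug in gu.
  case/gM; first by apply: prod_exp_Ndvd => //; rewrite eqxx.
  rewrite -mulr_natl; case/gM => [/dvdr_unit|].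
    rewrite -mpolyC_nat rmorph_unit ?unitfE; last first.
      by rewrite ((pcharf0P _).1 K0) -lt0n.
    by move=> /(_ isT) ug; rewrite ug in gu.
  move=> [u eu].
  have u0 : u != 0 by apply: contraNneq hj0 => u0; rewrite eu u0 mulr0.
  have u1 : multideg u = 0%MM.
    apply/mnmP => i; rewrite mnm0E; apply/eqP.
    have /in_polysE/(_ i) := hin j; rewrite eu multidegM// mnmDE.
    by rewrite -[leqRHS]addn0 leq_add2l leqn0.
  move: (hb j) u0; rewrite eu (multideg0_const u1) mulrC mcoeffCM => /eqP.
  by rewrite mulf_eq0 (negPf (gb j)) orbF mpolyC_eq0 => ->.
split=> //; move: e; rewrite coef1M c0 c1.
rewrite [X in _ + X](_ : _ = a%:MP * \prod_j g j ^+ k j); last first.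
  congr (_ * _); rewrite coef0_prod.
  by apply: eq_bigr => j _; rewrite coef0_exp c0.
rewrite [X in _ * X](_ : _ = 0); last first.
  under eq_bigr do rewrite h0 polyC0 mul0r addr0 -rmorphXn/=.
  by rewrite -rmorph_prod coefC.
rewrite mulr0 add0r => /eqP; rewrite mulf_eq0 mpolyC_eq0 => /orP[/eqP//|].
by rewrite prodf_seq_eq0 => /hasP[j _]/=; rewrite expf_eq0 (negPf (g0 j)) andbF.
Qed.

End UniqueFactorization.
End MultiPolyFactor.

From mathcomp Require Import all_classical all_reals all_analysis.
Import MultiPolyFactor.
Import numFieldNormedType.Exports.

Local Open Scope classical_set_scope.
Local Open Scope complex_scope.

(** * Norms and derivatives over the complex numbers *)

Section RealNorm.
Variable R : realType.
Local Notation C := (C R).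

(** Norms over the complex numbers are complex numbers, and the order on these is
    partial. Their real parts allow for minima and for linear arithmetic. *)
Definition rnorm (V : normedZmodType C) (v : V) : R := complex.Re (`|v| : R[i]).

Section Basic.
Variable V : normedZmodType C.
Implicit Types u v : V.

Lemma rnormE v : `|v| = (rnorm v)%:C :> R[i].
Proof. by rewrite /rnorm RRe_real// normr_real. Qed.

Lemma rnorm_ge0 v : 0 <= rnorm v.
Proof. by rewrite -lecR -rnormE; exact: (normr_ge0 v). Qed.

Lemma rnorm0 : rnorm (0 : V) = 0.
Proof. by rewrite /rnorm normr0. Qed.

Lemma rnorm_eq0 v : (rnorm v == 0) = (v == 0).
Proof.
rewrite -(normr_eq0 v); apply/eqP/eqP => [e|e]; last by rewrite /rnorm e.
by have := rnormE v; rewrite e.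
Qed.

Lemma rnormD u v : rnorm (u + v) <= rnorm u + rnorm v.
Proof. by rewrite -lecR rmorphD /= -!rnormE; exact: ler_normD. Qed.

Lemma rnormN v : rnorm (- v) = rnorm v.
Proof. by rewrite /rnorm normrN. Qed.

Lemma rnormB u v : rnorm (u - v) <= rnorm u + rnorm v.
Proof. by rewrite -(rnormN v); exact: rnormD. Qed.

Lemma rnormC u v : rnorm (u - v) = rnorm (v - u).
Proof. by rewrite -rnormN opprB. Qed.

Lemma rnorm_near u v (e : R) : rnorm (u - v) <= e -> rnorm u <= rnorm v + e.
Proof.
move=> h; have := rnormD v (u - v); rewrite addrC subrK => /le_trans; apply.
by rewrite lerD2l.
Qed.

Lemma rnorm_tri u v w : rnorm (u - w) <= rnorm (u - v) + rnorm (v - w).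
Proof. by rewrite (le_trans _ (rnormD _ _))// addrA subrK. Qed.

End Basic.

Lemma rnormM (a b : C) : rnorm (a * b) = rnorm a * rnorm b.
Proof. by apply: complexI; rewrite rmorphM /= -!rnormE; exact: normrM. Qed.

Lemma rnormR (x : R) : rnorm (x%:C : C) = `|x|.
Proof.
by rewrite /rnorm [`|_|](normc_def (x%:C)) /= expr0n addr0 sqrtr_sqr.
Qed.

Lemma rnormZ (V : normedModType C) (a : C) (v : V) : rnorm (a *: v) = rnorm a * rnorm v.
Proof. by apply: complexI; rewrite rmorphM /= -!rnormE; exact: normrZ. Qed.

Lemma rnormV (c : C) : rnorm c^-1 = (rnorm c)^-1.
Proof.
have [->|c0] := eqVneq c 0; first by rewrite invr0 rnorm0 invr0.
have nc0 : rnorm c != 0 by rewrite rnorm_eq0.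
apply: (mulfI nc0); rewrite -rnormM !divff//.
by have := rnormR (1 : R); rewrite normr1.
Qed.

Lemma nbhs_rnormP (V : pseudoMetricNormedZmodType C) (x : V) (P : set V) :
  nbhs x P <-> exists2 e : R, 0 < e & forall y, rnorm (y - x) < e -> P y.
Proof.
split=> [/nbhs_normP[e /= e0 eP]|[e e0 eP]].
  exists (complex.Re (e : R[i])).
    by move: e0; rewrite ltcE => /andP[].
  move=> y ye; apply: eP; rewrite /= distrC (rnormE (y - x)).
  move: e0; rewrite !ltcE /= => /andP[/eqP -> _].
  by rewrite eqxx.
apply/nbhs_normP; exists (e%:C : C) => /=; first by rewrite ltcR.
by move=> y /=; rewrite distrC (rnormE (y - x)) ltcR => /eP.
Qed.

Lemma rnorm_coord m n (v : 'M[C]_(m, n)) i j : rnorm (v i j) <= rnorm v.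
Proof.
have : `|v i j| <= mx_norm v.
  by rewrite mx_normE -[leLHS]nngE num_le; exact: (le_bigmax _ _ (i, j)).
by rewrite -lecR -!rnormE.
Qed.

Lemma rnorm_mx_le m n (v : 'M[C]_(m, n)) (e : R) : 0 <= e ->
  (forall i j, rnorm (v i j) <= e) -> rnorm v <= e.
Proof.
move=> e0 ve; have [->|v0] := eqVneq v 0; first by rewrite rnorm0.
have [[i j] /= eij] : exists ij, mx_norm v = `|v ij.1 ij.2|.
  by apply: mx_norm_neq0; rewrite -[mx_norm v]/(`|v|) normr_eq0.
by have := ve i j; rewrite {1}/rnorm -eij.
Qed.

Lemma rnorm_sum (I : Type) (V : normedZmodType C) (s : seq I) (P : pred I) (F : I -> V) :
  rnorm (\sum_(i <- s | P i) F i) <= \sum_(i <- s | P i) rnorm (F i).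
Proof.
elim/big_ind2 : _ => //; first by rewrite rnorm0.
by move=> x a y b xa yb; rewrite (le_trans (rnormD _ _))// lerD.
Qed.

(** A bound for the operator norm. *)
Definition mxbound p q (A : 'M[C]_(p, q)) : R := \sum_i \sum_j rnorm (A i j).

Lemma mxbound_ge0 p q (A : 'M[C]_(p, q)) : 0 <= mxbound A.
Proof. by apply: sumr_ge0 => i _; apply: sumr_ge0 => j _; exact: rnorm_ge0. Qed.

Lemma rnorm_mulmx n p q (h : 'M[C]_(n, p)) (A : 'M[C]_(p, q)) :
  rnorm (h *m A) <= mxbound A * rnorm h.
Proof.
apply: rnorm_mx_le => [|i j]; first by rewrite mulr_ge0 ?mxbound_ge0 ?rnorm_ge0.
rewrite mxE (le_trans (rnorm_sum _ _ _))// mulr_suml; apply: ler_sum => k _.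
rewrite rnormM mulrC ler_pM ?rnorm_ge0 ?rnorm_coord//.
by rewrite (bigD1 j)//= lerDl sumr_ge0// => j' _; exact: rnorm_ge0.
Qed.

Definition has_deriv p q (f : 'rV[C]_p -> 'rV[C]_q) x (A : 'M[C]_(p, q)) : Prop :=
  forall e : R, 0 < e -> exists2 d : R, 0 < d &
    forall y, rnorm (y - x) < d -> rnorm (f y - f x - (y - x) *m A) <= e * rnorm (y - x).

Lemma mulmxr_continuous n p q (A : 'M[C]_(p, q)) :
  continuous (mulmxr A : 'M[C]_(n, p) -> 'M[C]_(n, q)).
Proof.
move=> x P /nbhs_rnormP[e e0 eP]; apply/nbhs_rnormP.
have c0 : 0 < mxbound A + 1 by rewrite ltr_wpDl ?mxbound_ge0.
exists (e / (mxbound A + 1)) => [|y yx]; first by rewrite divr_gt0.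
apply: eP; rewrite /= -mulmxBl (le_lt_trans (rnorm_mulmx _ _))//.
move: yx; rewrite ltr_pdivlMr// => /(le_lt_trans _); apply.
by rewrite mulrC ler_wpM2l ?rnorm_ge0// lerDl.
Qed.

Lemma differentiable_rnormP p q (f : 'rV[C]_p -> 'rV[C]_q) x :
  differentiable f x <-> exists A, has_deriv f x A.
Proof.
split=> [df|[A dA]].
  exists (lin1_mx ('d f x)) => e e0.
  have /diff_locallyP[_ /eqaddoP] := df.
  move/(_ (e%:C : C)); rewrite /= ltcR => /(_ e0)/nbhs_rnormP[d d0 dP].
  exists d => // y yx; have := dP (y - x); rewrite subr0 => /(_ yx).
  rewrite !fctE /= subrK opprD addrA mul_rV_lin1 => le.
  by rewrite -lecR rmorphM /= -!rnormE.
have lf : f \o shift x = cst (f x) + (mulmxr A : 'rV_p -> 'rV_q) +o_ 0 id.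
  apply/eqaddoP => e /= e0.
  have er : e = (complex.Re (e : R[i]))%:C :> R[i].
    by rewrite RRe_real// realE (ltW e0).
  have er0 : 0 < complex.Re (e : R[i]) by rewrite -ltcR -er.
  have [d d0 dP] := dA _ er0.
  apply/nbhs_rnormP; exists d => // h; rewrite subr0 => hd.
  have := dP (h + x); rewrite addrK => /(_ hd).
  rewrite -lecR rmorphM /= -!rnormE -er !fctE /= opprD addrA.
  by [].
have cA := @mulmxr_continuous 1 p q A.
apply/diff_locallyP; rewrite (diff_unique cA lf); split=> //.
Qed.

(** The linear map [A - B] is arbitrarily small on short vectors, compared with
    their lengths; by homogeneity it vanishes. *)
Lemma has_deriv_unique p q (f : 'rV[C]_p -> 'rV[C]_q) x A B :
  has_deriv f x A -> has_deriv f x B -> A = B.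
Proof.
move=> dA dB; apply/row_matrixP => i; rewrite !rowE; set v := delta_mx _ _.
apply/eqP; rewrite -subr_eq0 -mulmxBr -rnorm_eq0; apply/negPn/negP => n0.
have {n0} n0 : 0 < rnorm (v *m (A - B)) by rewrite lt_def n0 rnorm_ge0.
have v0 : 0 < rnorm v.
  rewrite lt_def rnorm_ge0 rnorm_eq0 andbT; apply: contraTneq n0 => ->.
  by rewrite mul0mx rnorm0 ltxx.
pose e := rnorm (v *m (A - B)) / (4 * rnorm v).
have e0 : 0 < e by rewrite divr_gt0// mulr_gt0.
have [d1 d10 d1P] := dA e e0; have [d2 d20 d2P] := dB e e0.
pose t := Num.min d1 d2 / (2 * rnorm v).
have t0 : 0 < t by rewrite divr_gt0 ?mulr_gt0// lt_min d10.
pose y := x + (t%:C : C) *: v.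
have yx : y - x = (t%:C : C) *: v by rewrite /y addrC addKr.
have nyx : rnorm (y - x) = t * rnorm v by rewrite yx rnormZ rnormR ger0_norm// ltW.
have lt_y : rnorm (y - x) < Num.min d1 d2.
  rewrite nyx /t invfM mulrA mulfVK ?gt_eqF// ltr_pdivrMr//.
  by rewrite mulr_natr mulr2n ltrDl lt_min d10.
move: lt_y; rewrite lt_min => /andP[/d1P h1 /d2P h2].
have := rnormB (f y - f x - (y - x) *m B) (f y - f x - (y - x) *m A).
have -> : f y - f x - (y - x) *m B - (f y - f x - (y - x) *m A) =
    (t%:C : C) *: (v *m (A - B)).
  by rewrite opprB addrC addrA subrK -mulmxBr yx -scalemxAl.
rewrite rnormZ rnormR ger0_norm ?(ltW t0)//.
have et : e * (t * rnorm v) = t * rnorm (v *m (A - B)) / 4.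
  by rewrite /e; field; rewrite gt_eqF.
move: h1 h2; rewrite nyx et => h1 h2 h3.
have : 0 < t * rnorm (v *m (A - B)) by rewrite mulr_gt0.
lra.
Qed.

Lemma has_deriv_near p q (f g : 'rV[C]_p -> 'rV[C]_q) x A :
  (\forall y \near x, f y = g y) -> has_deriv f x A -> has_deriv g x A.
Proof.
move=> /nbhs_rnormP[d1 d10 d1P] df e e0; have [d d0 dP] := df e e0.
exists (Num.min d1 d); first by rewrite lt_min d10.
move=> y; rewrite lt_min => /andP[y1 y2].
by rewrite -(d1P y)// -(d1P x) ?subrr ?rnorm0//; exact: dP.
Qed.

Lemma has_deriv_continuous p q (f : 'rV[C]_p -> 'rV[C]_q) x A :
  has_deriv f x A -> {for x, continuous f}.
Proof. by move=> dA; apply: differentiable_continuous; apply/differentiable_rnormP; exists A. Qed.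

Lemma has_deriv_comp p q r (f : 'rV[C]_p -> 'rV[C]_q) (g : 'rV[C]_q -> 'rV[C]_r) x A B :
  has_deriv f x A -> has_deriv g (f x) B -> has_deriv (g \o f) x (A *m B).
Proof.
move=> df dg e e0.
pose M := mxbound A + mxbound B + 2.
have A0 := mxbound_ge0 A; have B0 := mxbound_ge0 B.
have M0 : 0 < M by rewrite /M; lra.
pose e1 := Num.min 1 (e / (2 * M)).
have e10 : 0 < e1 by rewrite lt_min ltr01 divr_gt0// mulr_gt0.
have e11 : e1 <= 1 by rewrite ge_min lexx.
have eM : e1 * (2 * M) <= e by rewrite -ler_pdivlMr ?mulr_gt0// ge_min lexx orbT.
have [d1 d10 d1P] := df e1 e10; have [d2 d20 d2P] := dg e1 e10.
exists (Num.min d1 (d2 / M)); first by rewrite lt_min d10 divr_gt0.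
move=> y; rewrite lt_min ltr_pdivlMr// => /andP[/d1P yd1 yd2].
have := rnorm_ge0 (y - x); set t := rnorm (y - x) in yd1 yd2 * => t0.
have fyx : rnorm (f y - f x) <= (mxbound A + 1) * t.
  have := rnormD (f y - f x - (y - x) *m A) ((y - x) *m A); rewrite subrK.
  move/le_trans; apply; rewrite addrC mulrDl mul1r lerD ?rnorm_mulmx//.
  by rewrite (le_trans yd1)// ler_piMl.
have fd2 : rnorm (f y - f x) < d2 by rewrite (le_lt_trans fyx)//; rewrite /M in yd2; nra.
have h2 := d2P _ fd2.
have h3 := rnorm_mulmx (f y - f x - (y - x) *m A) B.
rewrite /= (_ : _ - (y - x) *m (A *m B) = (g (f y) - g (f x) - (f y - f x) *m B) +
  (f y - f x - (y - x) *m A) *m B); last first.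
  by rewrite [(_ - (y - x) *m A) *m B]mulmxBl mulmxA addrA subrK.
rewrite (le_trans (rnormD _ _))//.
have : mxbound B * rnorm (f y - f x - (y - x) *m A) <= mxbound B * (e1 * t).
  by rewrite ler_wpM2l.
have : e1 * rnorm (f y - f x) <= e1 * ((mxbound A + 1) * t) by rewrite ler_wpM2l ?(ltW e10).
have : e1 * (2 * M) * t <= e * t by rewrite ler_wpM2r.
rewrite /M; have : 0 <= e1 * t by rewrite mulr_ge0 ?(ltW e10).
move: h2 h3; set a := mxbound A; set b := mxbound B.
have : 0 <= e1 * t * a by rewrite !mulr_ge0 ?(ltW e10).
have : 0 <= e1 * t * b by rewrite !mulr_ge0 ?(ltW e10).
nra.
Qed.

(** * Compactness *)

Lemma rnorm_continuous (V : pseudoMetricNormedZmodType C) : continuous (@rnorm V).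
Proof.
move=> x P /nbhs_ballP[e /= e0 eP]; apply/nbhs_rnormP; exists e => // y yx.
apply: eP; rewrite /ball /= (le_lt_trans _ yx)// ler_norml.
have := rnorm_tri x y 0; have := rnorm_tri y x 0; rewrite !subr0 (rnormC x y); lra.
Qed.

Lemma closed_rnorm_le (V : pseudoMetricNormedZmodType C) (M : R) :
  closed [set v : V | rnorm v <= M].
Proof.
apply: (@preimage_closed _ _ (@rnorm V) [set x | x <= M]); last exact: closed_le.
by move=> x _; exact: rnorm_continuous.
Qed.

Lemma rnorm_complex_le (a b : R) : rnorm (a +i* b : C) <= `|a| + `|b|.
Proof.
have -> : (a +i* b : C) = (a%:C : C) + (0 +i* b : C).
  by apply/eqP; rewrite eq_complex /= addr0 add0r !eqxx.
apply: le_trans (rnormD _ _) _; rewrite rnormR lerD2l.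
by rewrite /rnorm [`|_|](normc_def (0 +i* b)) /= expr0n add0r sqrtr_sqr.
Qed.

(** The disc is a closed subset of the image of a square of the real plane. *)
Lemma compact_disc (M : R) : compact [set z : C | rnorm z <= M].
Proof.
pose f (z : R * R) : C := z.1 +i* z.2.
have cf : continuous f.
  move=> z P /nbhs_rnormP[e e0 eP].
  have : nbhs z (ball z (e / 2)) by apply: nbhsx_ballx; rewrite divr_gt0.
  apply: filterS => y [/= b1 b2]; apply: eP.
  have -> : f y - f z = (y.1 - z.1) +i* (y.2 - z.2) by [].
  apply: le_lt_trans (rnorm_complex_le _ _) _.
  move: b1 b2; rewrite /ball /= (distrC z.1) (distrC z.2); lra.
have cI : compact (`[- M, M]%classic `*` `[-M, M]%classic : set (R * R)).
  by apply: compact_setX; exact: segment_compact.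
have cI' := continuous_compact (continuous_subspaceT cf) cI.
apply: (subclosed_compact _ cI'); first exact: closed_rnorm_le.
move=> z /= zM; exists (complex.Re (z : R[i]), complex.Im (z : R[i])); last first.
  by rewrite /f; case: z {zM}.
have zE : rnorm z = Num.sqrt (complex.Re (z : R[i]) ^+ 2 + complex.Im (z : R[i]) ^+ 2).
  by rewrite /rnorm [`|_|](normc_def z).
have sq_le (a b : R) : `|a| <= Num.sqrt (a ^+ 2 + b ^+ 2).
  by rewrite -sqrtr_sqr ler_wsqrtr// lerDl sqr_ge0.
split; rewrite /= in_itv /= -ler_norml (le_trans _ zM)// zE //.
by rewrite addrC sq_le.
Qed.

Lemma compact_rnorm_ball n (M : R) : compact [set v : 'rV[C]_n | rnorm v <= M].
Proof.
have [M0|M0] := ltP M 0.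
  rewrite (_ : [set _ | _] = set0); first exact: compact0.
  rewrite predeqE => v; split=> //= vM.
  by have := lt_le_trans M0 (le_trans (rnorm_ge0 v) vM); rewrite ltxx.
have := @rV_compact C n (fun=> [set z | rnorm z <= M]) (fun=> @compact_disc M).
congr compact; rewrite predeqE => v; split => /=.
  by move=> vM; apply: rnorm_mx_le => // i j; rewrite (ord1 i).
by move=> vM i; exact: le_trans (rnorm_coord _ _ _) vM.
Qed.

End RealNorm.

(** * The inverse function theorem *)

Section InverseFunction.
Variable R : realType.
Local Notation C := (C R).

Section NearIdentity.
Variables (N : nat) (F : 'rV[C]_N -> 'rV[C]_N) (rho : R).
Hypothesis F0 : F 0 = 0.
Hypothesis F_near_id : forall y z, rnorm y < rho -> rnorm z < rho ->
  rnorm (F y - F z - (y - z)) <= rnorm (y - z) / 2.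
Hypothesis F_cont : continuous F.

Lemma near_id_lip y z : rnorm y < rho -> rnorm z < rho ->
  rnorm (y - z) <= 2 * rnorm (F y - F z).
Proof.
move=> ly lz; have h := F_near_id ly lz.
have := rnormB (F y - F z) (F y - F z - (y - z)); rewrite opprB addrC subrK.
by lra.
Qed.

(** The iteration [y_(n+1) = y_n + (z - F y_n)] halves the distance from [F y_n] to
    [z] and stays in the ball of radius [2 * |z|]. So [z] is in the closure of the
    image of this ball, and this image is compact, hence closed. *)
Lemma near_id_onto z : rnorm z < rho / 2 -> exists2 y, rnorm y < rho & F y = z.
Proof.
move=> lz; pose y := fix y n := if n is n'.+1 then y n' + (z - F (y n')) else 0.
have z0 := rnorm_ge0 z.
have yP n : rnorm (y n) <= 2 * rnorm z * (1 - 2^-1 ^+ n) /\ rnorm (z - F (y n)) <= rnorm z * 2^-1 ^+ n.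
  elim: n => [|n [IH1 IH2]]; first by rewrite /= F0 rnorm0 subr0 expr0; split; lra.
  have p0 : 0 <= (2^-1 : R) ^+ n by rewrite exprn_ge0// invr_ge0.
  have h1 : rnorm (y n.+1) <= 2 * rnorm z * (1 - 2^-1 ^+ n.+1).
    apply: le_trans (rnormD _ _) _; rewrite exprS; nra.
  have lt_y k : rnorm (y k) <= 2 * rnorm z * (1 - 2^-1 ^+ k) -> rnorm (y k) < rho.
    have : 0 <= (2^-1 : R) ^+ k by rewrite exprn_ge0// invr_ge0.
    nra.
  split=> //; have := F_near_id (lt_y _ h1) (lt_y _ IH1).
  have -> : y n.+1 - y n = z - F (y n) by rewrite /= addrC addKr.
  rewrite opprB addrA subrK rnormC exprS; nra.
have cB := @compact_rnorm_ball R N (2 * rnorm z).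
have := continuous_compact (continuous_subspaceT F_cont) cB.
move/(compact_closed (@norm_hausdorff _ _)) => clo.
have : closure (F @` [set v | rnorm v <= 2 * rnorm z]) z.
  move=> B /nbhs_rnormP[e e0 eB].
  have e1 : 0 < e / (rnorm z + 1) by rewrite divr_gt0// ltr_wpDl.
  have [n _ /(_ n (leqnn n))] := near_infty_natSinv_expn_lt (PosNum e1).
  rewrite /= ltr_pdivlMr ?ltr_wpDl// div1r -exprVn => hn.
  have [y1 y2] := yP n.
  have p0 : 0 < (2^-1 : R) ^+ n by rewrite exprn_gt0// invr_gt0.
  exists (F (y n)); split; first by exists (y n) => //=; nra.
  by apply: eB; rewrite rnormC; nra.
rewrite -(closure_id _).1// => -[v /= vz <-]; exists v => //.
by apply: le_lt_trans vz _; lra.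
Qed.

Definition near_id_inv z := xget 0 [set y | rnorm y < rho /\ F y = z].

Lemma near_id_invP z : rnorm z < rho / 2 ->
  rnorm (near_id_inv z) < rho /\ F (near_id_inv z) = z.
Proof.
move=> /near_id_onto[y yr yz].
by apply: (@xgetPex _ 0 [set y | rnorm y < rho /\ F y = z]); exists y.
Qed.

Lemma near_id_invK y : rnorm y < rho -> rnorm (F y) < rho / 2 -> near_id_inv (F y) = y.
Proof.
move=> yr /near_id_invP[hr hF]; apply/eqP; rewrite -subr_eq0 -rnorm_eq0.
by rewrite eq_le rnorm_ge0 andbT; have := near_id_lip hr yr; rewrite hF subrr rnorm0 mulr0.
Qed.

(** [A] is injective because [F] multiplies distances by at least 1/2. For the
    same reason the increments of the inverse are at most twice those of its
    argument, so that errors that are small compared with the former are small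
    compared with the latter. *)
Lemma near_id_inv_deriv z A : rnorm z < rho / 2 -> has_deriv F (near_id_inv z) A ->
  has_deriv near_id_inv z (invmx A).
Proof.
move=> zr dA; have [yr yz] := near_id_invP zr; set y := near_id_inv z in dA yr yz *.
have Aunit : A \in unitmx.
  rewrite -row_free_unit; apply: inj_row_free => v vA.
  (* If [v] were a nonzero vector of the kernel, [F] would move by too little in
     the direction [v]; 1/4 is any constant below the 1/2 of [near_id_lip]. *)
  have [d d0 dP] := dA (4^-1) ltac:(lra).
  apply/eqP/negPn/negP => v0.
  have nv : 0 < rnorm v by rewrite lt_def rnorm_ge0 rnorm_eq0 v0.
  pose d' := Num.min d (rho - rnorm y).
  have d'0 : 0 < d' by rewrite lt_min d0 subr_gt0.
  pose t := d' / (2 * rnorm v).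
  have t0 : 0 < t by rewrite divr_gt0 ?mulr_gt0.
  pose y' := y + (t%:C : C) *: v.
  have yy : y' - y = (t%:C : C) *: v by rewrite /y' addrC addKr.
  have nyy : rnorm (y' - y) = d' / 2.
    by rewrite yy rnormZ rnormR ger0_norm ?(ltW t0)// /t; field; rewrite gt_eqF.
  have : rnorm (y' - y) < d' by rewrite nyy; lra.
  rewrite lt_min => /andP[yd yd2].
  have y'r : rnorm y' < rho by have := rnormD (y' - y) y; rewrite subrK; lra.
  have := dP _ yd; rewrite (_ : (y' - y) *m A = 0) ?subr0; last first.
    by rewrite yy -scalemxAl vA scaler0.
  have := near_id_lip y'r yr; rewrite nyy; lra.
move=> e e0; have B0 := mxbound_ge0 (invmx A).
pose e1 := e / (2 * (mxbound (invmx A) + 1)).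
have e10 : 0 < e1 by rewrite divr_gt0//; lra.
have e1E : 2 * (mxbound (invmx A) + 1) * e1 = e.
  by rewrite /e1; field; rewrite gt_eqF//; lra.
have [d d0 dP] := dA _ e10.
exists (Num.min (d / 2) (rho / 2 - rnorm z)); first by rewrite lt_min subr_gt0 zr divr_gt0.
move=> z'; rewrite lt_min => /andP[z'd z'r].
have lz' : rnorm z' < rho / 2 by have := rnormD (z' - z) z; rewrite subrK; lra.
have [y'r y'z] := near_id_invP lz'; set y' := near_id_inv z' in y'r y'z *.
have := near_id_lip y'r yr; rewrite y'z yz => lip.
have lt_d : rnorm (y' - y) < d by lra.
have := dP _ lt_d; rewrite y'z yz => h.
have -> : y' - y - (z' - z) *m invmx A =
    - ((z' - z - (y' - y) *m A) *m invmx A).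
  by rewrite [in RHS]mulmxBl mulmxK// opprB.
rewrite rnormN (le_trans (rnorm_mulmx _ _))// -e1E.
have h2 : mxbound (invmx A) * rnorm (z' - z - (y' - y) *m A) <=
  mxbound (invmx A) * (e1 * (2 * rnorm (z' - z))).
  by rewrite ler_wpM2l// (le_trans h)// ler_wpM2l// ltW.
apply: le_trans h2 _; rewrite -subr_ge0.
rewrite (_ : _ - _ = 2 * (e1 * rnorm (z' - z))); last by ring.
by rewrite mulr_ge0// mulr_ge0 ?rnorm_ge0// ltW.
Qed.

End NearIdentity.

(** Both points vary, unlike in [has_deriv]: this is what makes a function close to
    its derivative a Lipschitz perturbation of it. *)
Definition strict_deriv p q (f : 'rV[C]_p -> 'rV[C]_q) x (A : 'M[C]_(p, q)) : Prop :=
  forall e : R, 0 < e -> exists2 d : R, 0 < d &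
    forall y z, rnorm (y - x) < d -> rnorm (z - x) < d ->
      rnorm (f y - f z - (y - z) *m A) <= e * rnorm (y - z).

Lemma strict_deriv_has_deriv p q (f : 'rV[C]_p -> 'rV[C]_q) x A :
  strict_deriv f x A -> has_deriv f x A.
Proof.
move=> dA e e0; have [d d0 dP] := dA e e0; exists d => // y yd.
by apply: dP; rewrite // subrr rnorm0.
Qed.

(** With [P] a right inverse of [A], the map
    [F y = psi (x0 + y P) - psi x0 + y (1 - P A)] of the target space to itself has
    the identity as derivative at 0, and [F ((x - x0) A) = psi x - psi x0]. Hence
    [x] is recovered from [psi x] as [x0 + F^-1 (psi x - psi x0) P]. *)
Lemma immersion_left_inverse d N (psi : 'rV[C]_d -> 'rV[C]_N) x0 A :
  strict_deriv psi x0 A -> row_free A -> (forall x, exists B, has_deriv psi x B) ->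
  exists (Phi : 'rV[C]_N -> 'rV[C]_d) (d1 d2 : R),
    [/\ 0 < d1, 0 < d2,
        forall z, rnorm (z - psi x0) < d2 -> differentiable Phi z &
        forall x, rnorm (x - x0) < d1 ->
          rnorm (psi x - psi x0) < d2 /\ Phi (psi x) = x].
Proof.
move=> dA freeA dpsi.
have [P AP] : exists P, A *m P = 1%:M by exists (pinvmx A); exact: mulmxVp.
have [Q QE] : exists Q, Q = 1%:M - P *m A by exists (1%:M - P *m A).
pose F y := psi (x0 + y *m P) - psi x0 + y *m Q.
have dF y : exists B, has_deriv F y B.
  have [B dB] := dpsi (x0 + y *m P); exists (P *m B + Q).
  have P0 := mxbound_ge0 P.
  move=> e e0; pose e1 := e / (mxbound P + 1).
  have e10 : 0 < e1 by rewrite divr_gt0//; lra.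
  have [c c0 cP] := dB _ e10.
  exists (c / (mxbound P + 1)); first by rewrite divr_gt0//; lra.
  move=> z; rewrite ltr_pdivlMr ?ltr_wpDl// => zy.
  have zP : (x0 + z *m P) - (x0 + y *m P) = (z - y) *m P.
    by rewrite opprD addrACA subrr add0r mulmxBl.
  have lP := rnorm_mulmx (z - y) P.
  have zy0 := rnorm_ge0 (z - y).
  have := cP (x0 + z *m P); rewrite zP => /(_ ltac:(nra)) h.
  have -> : F z - F y - (z - y) *m (P *m B + Q) =
     psi (x0 + z *m P) - psi (x0 + y *m P) - (z - y) *m P *m B.
    rewrite /F mulmxDr mulmxA [(z - y) *m Q]mulmxBl.
    set a := psi _; set b := psi _; set c' := psi _.
    set u := z *m _; set v := y *m _; set w := _ *m _.
    by apply/rowP => i; rewrite !mxE; ring.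
  rewrite (le_trans h)//.
  have : e1 * rnorm ((z - y) *m P) <= e1 * ((mxbound P + 1) * rnorm (z - y)).
    by rewrite ler_wpM2l ?(ltW e10)//; lra.
  have -> : e1 * ((mxbound P + 1) * rnorm (z - y)) = e * rnorm (z - y).
    by rewrite /e1; field; rewrite gt_eqF//; lra.
  by [].
have F0 : F 0 = 0 by rewrite /F !mul0mx !addr0 subrr.
have Fcont : continuous F.
  by move=> y; have [B dB] := dF y; exact: has_deriv_continuous dB.
have P0 := mxbound_ge0 P.
(* This makes [F] differ from the identity by a 1/2-Lipschitz map, the distances
   being multiplied by at most [mxbound P] before [psi] is applied. *)
pose e1 := (2 * (mxbound P + 1))^-1.
have e1P : e1 * (mxbound P + 1) = 1 / 2 by rewrite /e1; field; rewrite gt_eqF//; lra.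
have e10 : 0 < e1 by rewrite invr_gt0; lra.
have [c c0 cP] := dA _ e10.
pose rho := c / (mxbound P + 1).
have rho0 : 0 < rho by rewrite divr_gt0//; lra.
have rhoE : rho * (mxbound P + 1) = c by rewrite /rho; field; rewrite gt_eqF//; lra.
have Fid y z : rnorm y < rho -> rnorm z < rho -> rnorm (F y - F z - (y - z)) <= rnorm (y - z) / 2.
  have Pc v : rnorm v < rho -> rnorm (x0 + v *m P - x0) < c.
    move=> vr; rewrite addrC addKr (le_lt_trans (rnorm_mulmx _ _))//.
    by have := rnorm_ge0 v; nra.
  move=> /Pc yc /Pc zc; have := cP _ _ yc zc.
  rewrite opprD addrACA subrr add0r -mulmxBl => h.
  have -> : F y - F z - (y - z) = psi (x0 + y *m P) - psi (x0 + z *m P) -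
      (y - z) *m P *m A.
    rewrite /F QE !mulmxBr !mulmx1 mulmxBl [(_ - _) *m A]mulmxBl !mulmxA.
    set a := psi _; set b := psi _; set c' := psi _.
    set u := _ *m _; set v := _ *m _.
    by apply/rowP => i; rewrite !mxE; ring.
  rewrite (le_trans h)// (le_trans (ler_wpM2l (ltW e10) (rnorm_mulmx _ _)))//.
  rewrite mulrA [leRHS]mulrC ler_wpM2r ?rnorm_ge0//.
  by rewrite -[2^-1]mul1r -e1P ler_wpM2l ?(ltW e10)// lerDl ler01.
have FA x : F ((x - x0) *m A) = psi x - psi x0.
  rewrite /F -mulmxA AP mulmx1 [x0 + _]addrC subrK QE mulmxBr mulmx1 mulmxA.
  by rewrite -[_ *m A *m P]mulmxA AP mulmx1 subrr addr0.
pose H := near_id_inv F rho.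
pose d2 := rho / 2.
have dpsi0 := strict_deriv_has_deriv dA.
have /has_deriv_continuous := dpsi0.
move=> /(_ [set z | rnorm (z - psi x0) < d2]) /= cont0.
have /nbhs_rnormP[d1 d10 d1P] : nbhs x0 [set x | rnorm (psi x - psi x0) < d2].
  by apply: cont0; apply/nbhs_rnormP; exists d2 => //; rewrite divr_gt0.
have A0 := mxbound_ge0 A.
exists (fun z => x0 + H (z - psi x0) *m P), (Num.min d1 (rho / (mxbound A + 1))), d2.
split; first by rewrite lt_min d10 divr_gt0//; lra.
- by rewrite divr_gt0.
- move=> z zd; apply/differentiable_rnormP.
  have [B dB] := dF (H (z - psi x0)).
  have dH := near_id_inv_deriv F0 Fid Fcont zd dB.
  exists (invmx B *m P) => e e0.
  have e20 : 0 < e / (mxbound P + 1) by rewrite divr_gt0//; lra.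
  have [c1 c10 c1P] := dH _ e20.
  exists c1 => // y yz.
  have := c1P (y - psi x0); rewrite opprB addrA subrK => /(_ yz) h.
  rewrite opprD addrACA subrr add0r -mulmxBl mulmxA -mulmxBl.
  rewrite (le_trans (rnorm_mulmx _ _))//.
  have -> : e = (mxbound P + 1) * (e / (mxbound P + 1)).
    by field; rewrite gt_eqF//; lra.
  rewrite -mulrA ler_pM ?rnorm_ge0//; lra.
- move=> x; rewrite lt_min ltr_pdivlMr ?ltr_wpDl// => /andP[/d1P /= xd xr].
  split=> //; rewrite -FA /H near_id_invK//.
  + by rewrite -mulmxA AP mulmx1 addrC subrK.
  + by rewrite (le_lt_trans (rnorm_mulmx _ _))//; have := rnorm_ge0 (x - x0); nra.
  + by rewrite FA.
Qed.

End InverseFunction.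

(** * Continuous families of polynomials *)

Section ContinuousFamilies.
Variables (R : realType) (l : nat) (T : topologicalType).
Local Notation C := (C R).
Local Notation mcoeff := mpoly.mcoeff.
Implicit Types (t : T) (P Q : T -> mpoly l C).

(** Coefficientwise continuity: it makes sense for families of unbounded degree,
    and is stable under products. *)
Definition mcontinuous t P : Prop :=
  forall a, {for t, continuous (fun t => mcoeff a (P t) : C)}.

Lemma continuous_add_at (f g : T -> C) t :
  {for t, continuous f} -> {for t, continuous g} ->
  {for t, continuous (fun t => f t + g t)}.
Proof. by move=> cf cg; exact: (@continuousD _ C T f g t cf cg). Qed.

Lemma continuous_mul_at (f g : T -> C) t :
  {for t, continuous f} -> {for t, continuous g} ->
  {for t, continuous (fun t => f t * g t)}.
Proof. by move=> cf cg; exact: (@continuousM _ T f g t cf cg). Qed.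

Lemma continuous_sum_at (I : Type) (s : seq I) (p : pred I) (F : I -> T -> C) t :
  (forall i, {for t, continuous (F i)}) ->
  {for t, continuous (fun t => \sum_(i <- s | p i) F i t)}.
Proof.
move=> cF; elim: s => [|i s IH].
  under [X in {for _, continuous X}]funext do rewrite big_nil.
  exact: cst_continuous.
under [X in {for _, continuous X}]funext do rewrite big_cons.
case: (p i); last exact: IH.
exact: (continuous_add_at (cF i) IH).
Qed.

Lemma continuous_exp_at (f : T -> C) t n :
  {for t, continuous f} -> {for t, continuous (fun t => f t ^+ n)}.
Proof.
move=> cf; elim: n => [|n IH].
  under [X in {for _, continuous X}]funext do rewrite expr0.
  exact: cst_continuous.
under [X in {for _, continuous X}]funext do rewrite exprS.
exact: (continuous_mul_at cf IH).
Qed.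

Lemma continuous_prod_at (I : Type) (s : seq I)
    (F : I -> T -> C) t : (forall i, {for t, continuous (F i)}) ->
  {for t, continuous (fun t => \prod_(i <- s) F i t)}.
Proof.
move=> cF; elim: s => [|i s IH].
  under [X in {for _, continuous X}]funext do rewrite big_nil.
  exact: cst_continuous.
under [X in {for _, continuous X}]funext do rewrite big_cons.
exact: (continuous_mul_at (cF i) IH).
Qed.

Lemma mcontinuousM t P Q : mcontinuous t P -> mcontinuous t Q ->
  mcontinuous t (fun t => P t * Q t).
Proof.
move=> cP cQ a.
under [X in {for _, continuous X}]funext do rewrite mpoly.mcoeffM.
apply: continuous_sum_at => i; exact: (continuous_mul_at (cP _) (cQ _)).
Qed.

Lemma mcontinuous_cst t (f : mpoly l C) : mcontinuous t (fun=> f).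
Proof. by move=> a; exact: cst_continuous. Qed.

Lemma mcontinuousZ t (c : T -> C) P : {for t, continuous c} -> mcontinuous t P ->
  mcontinuous t (fun t => c t *: P t).
Proof.
move=> cc cP a.
under [X in {for _, continuous X}]funext do rewrite mpoly.mcoeffZ.
exact: (continuous_mul_at cc (cP a)).
Qed.

Lemma mcontinuousX t P n : mcontinuous t P -> mcontinuous t (fun t => P t ^+ n).
Proof.
move=> cP; elim: n => [|n IH].
  by under [X in mcontinuous _ X]funext do rewrite expr0; exact: mcontinuous_cst.
under [X in mcontinuous _ X]funext do rewrite exprS.
exact: (mcontinuousM cP IH).
Qed.

Lemma mcontinuous_prod (I : Type) (s : seq I) (F : I -> T -> mpoly l C) t :
  (forall i, mcontinuous t (F i)) ->
  mcontinuous t (fun t => \prod_(i <- s) F i t).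
Proof.
move=> cF; elim: s => [|i s IH].
  by under [X in mcontinuous _ X]funext do rewrite big_nil; exact: mcontinuous_cst.
under [X in mcontinuous _ X]funext do rewrite big_cons.
exact: (mcontinuousM (cF i) IH).
Qed.

Lemma continuous_rV_at n (v : T -> 'rV[C]_n) t :
  (forall i, {for t, continuous (fun t => v t 0 i : C)}) -> {for t, continuous v}.
Proof.
move=> cv P /nbhs_rnormP[e e0 eP].
have : \forall t' \near t, forall i, rnorm (v t' 0 i - v t 0 i) < e / 2.
  apply: filter_forall => i.
  have := cv i [set z | rnorm (z - v t 0 i) < e / 2]; apply; apply/nbhs_rnormP.
  by exists (e / 2); rewrite ?divr_gt0.
apply: filterS => t' ht; apply: eP.
apply: (@le_lt_trans _ _ (e / 2)); last lra.
apply: rnorm_mx_le => [|i j]; first by rewrite ltW// divr_gt0.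
by rewrite !mxE (ord1 i) ltW// ht.
Qed.

Lemma coefvec_continuous n P t : mcontinuous t P ->
  {for t, continuous (fun t => coefvec n (P t))}.
Proof.
move=> cP; apply: continuous_rV_at => i.
under [X in {for _, continuous X}]funext do rewrite mxE.
exact: cP.
Qed.

Lemma vecpoly_continuous n (v : T -> 'rV[C]_(dimP n)) t : {for t, continuous v} ->
  mcontinuous t (fun t => vecpoly (v t)).
Proof.
move=> cv a.
under [X in {for _, continuous X}]funext do rewrite mcoeff_vecpoly.
apply: continuous_sum_at => i.
have ci : {for t, continuous (fun t => v t 0 i : C)}.
  exact: (continuous_comp cv (@coord_continuous _ _ _ 0 i _)).
apply: (continuous_mul_at ci); exact: cst_continuous.
Qed.

Lemma near_mcoeff_neq0 t P a : mcontinuous t P -> mcoeff a (P t) != 0 ->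
  \forall t' \near t, mcoeff a (P t') != 0.
Proof.
move=> cP n0; have := cP a [set z | z != 0]; apply; apply/nbhs_rnormP.
exists (rnorm (mcoeff a (P t))); first by rewrite lt_def rnorm_eq0 n0 rnorm_ge0.
by move=> y; apply: contraTneq => ->; rewrite sub0r rnormN ltxx.
Qed.

(** In each variable, the maximal degree is witnessed by a coefficient that does not
    vanish at [t], hence does not vanish near [t]. *)
Lemma near_in_polys_exact n t P : mcontinuous t P -> in_polys_exact n (P t) ->
  (forall t', in_polys n (P t')) -> \forall t' \near t, in_polys_exact n (P t').
Proof.
move=> cP [P0 dP] Pn.
have n0 : \forall t' \near t, P t' != 0.
  have [a] : exists a, mcoeff a (P t) != 0.
    apply: contrapT => H; case/negP: P0; apply/eqP/mpoly.mpolyP => a.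
    by rewrite mpoly.mcoeff0; apply/eqP/negPn/negP => na; apply: H; exists a.
  move/(near_mcoeff_neq0 cP); apply: filterS => t'; apply: contra_neq => ->.
  by rewrite mpoly.mcoeff0.
have dn : \forall t' \near t, forall i, (n i <= multideg (P t') i)%N.
  apply: filter_forall => i.
  have [a aP ai] := degX_attained i P0.
  rewrite mpoly.mcoeff_msupp in aP.
  have := near_mcoeff_neq0 cP aP; apply: filterS => t' at'.
  rewrite -dP !mpoly.mnmE -ai; apply: degX_le.
  by rewrite mpoly.mcoeff_msupp.
near=> t'; split; first by near: t'.
apply/mpoly.mnmP => i; apply/eqP; rewrite eqn_leq.
apply/andP; split; first by have /in_polysE := Pn t'.
by move: i; near: t'.
Unshelve. all: by end_near. Qed.

End ContinuousFamilies.

(** * Limits of factorizations *)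

Section CompactFiber.
Variables (T U : topologicalType) (f : T -> U) (K Q : set T) (y : U).
Hypothesis hU : hausdorff_space U.
Hypothesis cf : continuous f.
Hypothesis cK : compact K.

(** The image of the part of [K] outside the interior of [Q] is compact, hence
    closed, and it does not contain [y]. *)
Lemma compact_fiber_near : (forall x, K x -> f x = y -> nbhs x Q) ->
  \forall y' \near y, forall x, K x -> f x = y' -> Q x.
Proof.
move=> HQ.
have cK' : compact (K `&` ~` Q^°).
  by apply: compact_closedI => //; apply: open_closedC; exact: open_interior.
have := compact_closed hU (continuous_compact (continuous_subspaceT cf) cK').
move=> /closed_openC; rewrite openE => /(_ y) ny.
have : nbhs y (~` (f @` (K `&` ~` Q^°))).
  by apply: ny => -[x [Kx nQ] fxy]; exact: nQ (HQ x Kx fxy).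
apply: filterS => y' ny' x Kx fx; apply: contrapT => nQ; apply: ny'.
by exists x => //; split => // /interior_subset.
Qed.

End CompactFiber.

Lemma vecpolyZ (K : fieldType) l n (c : K) (v : 'rV[K]_(@dimP l n)) :
  vecpoly (c *: v) = c *: vecpoly v.
Proof. by rewrite /vecpoly scaler_sumr; apply: eq_bigr => i _; rewrite mxE scalerA. Qed.

Lemma coefvecZ (K : fieldType) l n (c : K) (f : mpoly l K) :
  coefvec n (c *: f) = c *: coefvec n f.
Proof. by apply/rowP => i; rewrite !mxE mpoly.mcoeffZ. Qed.

Section FactorLimit.
Variables (R : realType) (l r : nat).
Local Notation C := (C R).
Variables (n : 'I_r -> multinom l) (k : 'I_r -> nat) (m : multinom l).
Hypothesis k0 : forall j, (0 < k j)%N.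
Hypothesis le_m : forall i, (\sum_j k j * n j i <= m i)%N.

(** The constant [alpha] and the coefficient vectors of the factors, with the
    product topology. *)
Definition coef_family (j : 'I_r) : topologicalType := 'rV[C]_(dimP (n j)).

Definition factor_space : topologicalType :=
  (C * prod_topology coef_family)%type.

Definition factor_coefs (p : factor_space) j : 'rV[C]_(dimP (n j)) := p.2 j.

Definition expansion (p : factor_space) : mpoly l C :=
  p.1 *: \prod_j vecpoly (factor_coefs p j) ^+ k j.

Lemma in_polys_prod_exp (c : C) (h : 'I_r -> mpoly l C) :
  (forall j, in_polys (n j) (h j)) ->
  in_polys m (c *: \prod_j h j ^+ k j).
Proof.
move=> hn; have [c0|c0] := eqVneq c 0.
  rewrite c0 scale0r -mpoly.mpolyC0; apply/in_polysE => i.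
  by rewrite multidegC mpoly.mnm0E.
have [/forallP h0|] := boolP [forall j, h j != 0].
  apply/in_polysE => i; rewrite multideg_prod_exp//.
  apply: leq_trans (le_m i); apply: leq_sum => j _.
  by rewrite leq_mul2l; have /in_polysE -> := hn j; rewrite orbT.
rewrite negb_forall => /existsP[j]; rewrite negbK => /eqP hj.
rewrite (bigD1 j)//= hj expr0n gtn_eqF// mul0r scaler0 -mpoly.mpolyC0.
by apply/in_polysE => i; rewrite multidegC mpoly.mnm0E.
Qed.

Lemma expansion_in p : in_polys m (expansion p).
Proof. by apply: in_polys_prod_exp => j; exact: vecpoly_in. Qed.

Lemma factor_coefs_continuous j (p : factor_space) :
  {for p, continuous (factor_coefs^~ j)}.
Proof.
have c1 : {for p, continuous (snd : factor_space -> prod_topology coef_family)}.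
  exact: cvg_snd.
exact: (continuous_comp c1 (@proj_continuous _ coef_family j p.2)).
Qed.

Lemma expansion_mcontinuous p : mcontinuous p expansion.
Proof.
apply: mcontinuousZ; first exact: cvg_fst.
apply: mcontinuous_prod => j; apply: mcontinuousX.
exact: (vecpoly_continuous (@factor_coefs_continuous j p)).
Qed.

Lemma expansion_continuous : continuous (coefvec m \o expansion).
Proof. by move=> p; exact: (coefvec_continuous (n := m) (@expansion_mcontinuous p)). Qed.

Definition sphere_factors : set (prod_topology coef_family) :=
  [set h | forall j, rnorm (h j : 'rV[C]_(dimP (n j))) = 1].

Lemma compact_sphere_factors : compact sphere_factors.
Proof.
apply: (@tychonoff _ coef_family
   (fun j => [set v | rnorm v = 1])) => j.
apply: (subclosed_compact _ (@compact_rnorm_ball R (dimP (n j)) 1)); last first.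
  by move=> v /= ->.
apply: (@preimage_closed _ _ (@rnorm R _) [set x | x = 1]).
  by move=> x _; exact: rnorm_continuous.
exact: closed_eq.
Qed.

Lemma expansion_eq0 p : (forall j, factor_coefs p j != 0) -> p.1 != 0 -> expansion p != 0.
Proof.
move=> p2 p1; rewrite scaler_eq0 negb_or p1; apply/prodf_neq0 => j _.
apply: expf_neq0; apply: contra_neq (p2 j) => e.
by rewrite -[factor_coefs p j]vecpolyK e; apply/rowP => i; rewrite !mxE mpoly.mcoeff0.
Qed.

Lemma coefvec_eq0 (f : mpoly l C) : in_polys m f -> coefvec m f = 0 -> f = 0.
Proof.
move=> fm e; apply: (coefvec_inj fm).
  by rewrite -mpoly.mpolyC0; apply/in_polysE => i; rewrite multidegC mpoly.mnm0E.
by rewrite e; apply/rowP => i; rewrite !mxE mpoly.mcoeff0.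
Qed.

(** Products of nonzero polynomials do not vanish, and the spheres are compact. The
    bound controls the constant of a factorization by the norm of the product. *)
Lemma sphere_lower_bound : exists2 c : R, 0 < c &
  forall h, sphere_factors h -> c <= rnorm (coefvec m (expansion (1, h))).
Proof.
have cK : compact ([set 1 : C] `*` sphere_factors).
  exact: compact_setX (@compact_set1 _ _) compact_sphere_factors.
have [|c c0 cP] := (nbhs_rnormP _ _).1 (@compact_fiber_near _ _ (coefvec m \o expansion)
    _ set0 0 (@norm_hausdorff _ _) expansion_continuous cK _).
  move=> -[c h] [/= -> hs] /(coefvec_eq0 (expansion_in _)) e; exfalso.
  have : expansion (1, h) != 0.
    apply: expansion_eq0; rewrite ?oner_eq0//= => j.
    by rewrite -rnorm_eq0 hs oner_eq0.
  by rewrite e eqxx.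
exists c => // h hs; rewrite leNgt; apply/negP => lt_c.
by apply: (cP (coefvec m (expansion (1, h))) _ (1, h)); rewrite ?subr0.
Qed.

(** A set [Q] that is a neighbourhood of every normalised expression of [f] as a
    product contains, up to rescaling of the factors, the expressions of all the
    polynomials near [f]. *)
Theorem factor_limit (f : mpoly l C) (Q : set factor_space) :
  in_polys m f -> f != 0 ->
  (forall p, sphere_factors p.2 -> expansion p = f -> nbhs p Q) ->
  \forall w \near coefvec m f, forall (c : C) (h : 'I_r -> mpoly l C),
    (forall j, in_polys (n j) (h j)) ->
    coefvec m (c *: \prod_j h j ^+ k j) = w ->
    exists2 p, Q p & expansion p = c *: \prod_j h j ^+ k j.
Proof.
move=> fm f0 HQ.
have [c c0 cP] := sphere_lower_bound.
(* The bound on the constant of a product at distance at most 1 of [f]. *)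
pose M := (rnorm (coefvec m f) + 1) / c.
have cK : compact ([set z : C | rnorm z <= M] `*` sphere_factors).
  exact: compact_setX (@compact_disc _ _) compact_sphere_factors.
have fn0 : 0 < rnorm (coefvec m f).
  rewrite lt_def rnorm_ge0 andbT rnorm_eq0; apply: contra_neq f0.
  exact: coefvec_eq0.
have /nbhs_rnormP[d d0 dP] := @compact_fiber_near _ _ (coefvec m \o expansion)
    _ Q (coefvec m f) (@norm_hausdorff _ _) expansion_continuous cK
    (fun p Kp e => HQ p Kp.2 (coefvec_inj (expansion_in p) fm e)).
apply/nbhs_rnormP; exists (Num.min d (Num.min 1 (rnorm (coefvec m f)))).
  by rewrite !lt_min d0 ltr01.
move=> w; rewrite !lt_min => /and3P[wd w1 wf] a h hn hw.
have w0 : w != 0.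
  by apply: contraTneq wf => ->; rewrite sub0r rnormN ltxx.
have h0 j : h j != 0.
  apply: contra_neq w0 => hj; rewrite -hw (bigD1 j)//= hj expr0n gtn_eqF//.
  by rewrite mul0r scaler0; apply/rowP => i; rewrite !mxE mpoly.mcoeff0.
pose v j := coefvec (n j) (h j).
have vE j : vecpoly (v j) = h j by exact: coefvecK.
have v0 j : rnorm (v j) != 0.
  rewrite rnorm_eq0; apply: contra_neq (h0 j) => e; rewrite -vE e.
  by rewrite /vecpoly big1// => i _; rewrite mxE scale0r.
pose s j : C := (rnorm (v j))%:C.
have s0 j : s j != 0 by rewrite /s -rnorm_eq0 rnormR normr_eq0.
pose p : factor_space := (a * \prod_j s j ^+ k j, fun j => (s j)^-1 *: v j).
have ep : expansion p = a *: \prod_j h j ^+ k j.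
  have pE j : vecpoly (factor_coefs p j) = (s j)^-1 *: h j by rewrite -vE -vecpolyZ.
  rewrite /expansion; under eq_bigr do rewrite pE exprZn.
  rewrite scaler_prod scalerA -mulrA -big_split /= big1 ?mulr1// => j _.
  by rewrite -exprMn divff// expr1n.
have sp : sphere_factors p.2.
  by move=> j /=; rewrite rnormZ rnormV rnormR ger0_norm ?rnorm_ge0// mulVf.
exists p => //; apply: (dP _ wd); last by rewrite /= ep.
split=> //=; rewrite -[a * _]/(p.1) /M ler_pdivlMr//.
have wE : rnorm w = rnorm p.1 * rnorm (coefvec m (expansion (1, p.2))).
  rewrite -hw -ep -rnormZ -coefvecZ; congr (rnorm (coefvec m _)).
  by rewrite /expansion /= scalerA mulr1.
apply: le_trans (ler_wpM2l (rnorm_ge0 p.1) (cP _ sp)) _.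
by rewrite -wE; apply: rnorm_near; exact: ltW.
Qed.

Corollary factor_closed (f : mpoly l C) :
  in_polys m f -> f != 0 ->
  (forall (c : C) (h : 'I_r -> mpoly l C), (forall j, in_polys (n j) (h j)) ->
    c *: \prod_j h j ^+ k j <> f) ->
  \forall w \near coefvec m f, forall (c : C) (h : 'I_r -> mpoly l C),
    (forall j, in_polys (n j) (h j)) -> coefvec m (c *: \prod_j h j ^+ k j) <> w.
Proof.
move=> fm f0 Hf; have := @factor_limit f set0 fm f0.
have H p : sphere_factors p.2 -> expansion p = f -> nbhs p set0.
  by move=> _ /Hf; case=> // j; exact: vecpoly_in.
by move=> /(_ H); apply: filterS => w Hw c h hn hw; have [] := Hw c h hn hw.
Qed.

End FactorLimit.

Lemma near_coefvec (R : realType) l (T : topologicalType) (t : T)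
    (P : T -> mpoly l (C R)) n (Q : set 'rV[C R]_(dimP n)) :
  mcontinuous t P -> (\forall w \near coefvec n (P t), Q w) ->
  \forall t' \near t, Q (coefvec n (P t')).
Proof. by move=> /(coefvec_continuous (n := n)) cP /cP. Qed.

Section OpenConditions.
Variables (R : realType) (l : nat) (T : topologicalType).
Local Notation C := (C R).
Implicit Types (t : T) (P : T -> mpoly l C) (n : multinom l).

Lemma multideg_mul_unit (f u : mpoly l C) :
  f != 0 -> u \is a GRing.unit -> multideg (f * u) = multideg f.
Proof.
move=> f0 uu; have u0 : u != 0 by apply: contraTneq uu => ->; rewrite unitr0.
by rewrite multidegM// (multideg_unit uu) mpoly.addm0.
Qed.

Lemma in_polysZ n (c : C) (f : mpoly l C) : in_polys n f -> in_polys n (c *: f).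
Proof.
have [->|c0] := eqVneq c 0; last by rewrite /in_polys multidegZ.
by rewrite scale0r -mpoly.mpolyC0 => _; apply/in_polysE => i; rewrite multidegC mpoly.mnm0E.
Qed.

Lemma irreducible_not_product n b (u v : mpoly l C) :
  irreducible_mpoly (u * v) -> multideg (u * v) = n ->
  in_polys b u -> in_polys (mpoly.mnm_sub n b) v ->
  mpoly.lem b n -> b != mpoly.mnm0 -> b != n -> False.
Proof.
move=> [uv0 _ irr] duv /in_polysE ub /in_polysE vb /mpoly.mnm_lepP bn b0 bneq.
move: (uv0); rewrite mulf_eq0 negb_or => /andP[u0 v0].
have eqd i : multideg u i = b i /\ multideg v i = (n i - b i)%N.
  have := congr1 (fun d : multinom l => d i) duv; rewrite multidegM// mpoly.mnmDE.
  by have := ub i; have := vb i; have := bn i; rewrite mpoly.mnmBE; lia.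
case: (irr u v erefl) => /multideg_unit d0.
  case/eqP: b0; apply/mpoly.mnmP => i.
  by have [<- _] := eqd i; rewrite d0.
case/eqP: bneq; apply/mpoly.mnmP => i.
by have [_] := eqd i; rewrite d0 mpoly.mnm0E; have := bn i; lia.
Qed.

(** The products of polynomials of degrees at most [b] and [n - b] form a closed
    set, and [P t] is not one of them. *)
Lemma near_not_product t P n b :
  mcontinuous t P -> irreducible_mpoly (P t) -> multideg (P t) = n ->
  (forall t', in_polys n (P t')) ->
  (mpoly.lem b n) -> b != mpoly.mnm0 -> b != n ->
  \forall t' \near t, forall u v, in_polys b u ->
    in_polys (mpoly.mnm_sub n b) v -> P t' != u * v.
Proof.
move=> cP irP dP Pn bn b0 bneq.
have [P0 Pu PM] := irP.
pose nn (j : 'I_2) := if j == 0 then b else mpoly.mnm_sub n b.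
have le_n i : (\sum_(j < 2) 1 * nn j i <= n i)%N.
  rewrite !big_ord_recl big_ord0 /nn /= mpoly.mnmBE !mul1n addn0 subnKC//.
  by have /mpoly.mnm_lepP := bn.
have no_factor (c : C) (h : 'I_2 -> mpoly l C) : (forall j, in_polys (nn j) (h j)) ->
    c *: \prod_j h j ^+ 1 <> P t.
  move=> hn; rewrite !big_ord_recl big_ord0 mulr1 !expr1 scalerAl => e.
  rewrite -e in irP dP.
  apply: (irreducible_not_product irP dP _ (hn (lift ord0 ord0)) bn b0 bneq).
  exact: in_polysZ (hn ord0).
have near_n := factor_closed (k := fun=> 1%N) (fun=> isT) le_n (Pn t) P0 no_factor.
have := near_coefvec cP near_n; apply: filterS => t' Ht' u v ub vb.
apply/negP => /eqP e.
case: (Ht' 1 (fun j : 'I_2 => if j == 0 then u else v)).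
  by move=> j; rewrite /nn; case: ifP.
by rewrite !big_ord_recl big_ord0 /= mulr1 !expr1 scale1r e.
Qed.

(** The degrees of the factors of a reducible polynomial of degree [n] are [b] and
    [n - b], where [b] takes only finitely many values. *)
Lemma near_irreducible t P n :
  mcontinuous t P -> in_polys_exact n (P t) -> irreducible_mpoly (P t) ->
  (forall t', in_polys n (P t')) -> \forall t' \near t, irreducible_mpoly (P t').
Proof.
move=> cP exP irP Pn; have [P0 dP] := exP.
have n0 : n != mpoly.mnm0.
  by case: irP => _ Pu _; apply: contraNneq Pu => n0; apply: unit_multideg0; rewrite // dP.
have nprod : \forall t' \near t, forall b : mpoly.bmultinom l (mpoly.mdeg n).+1,
    mpoly.lem b n -> mpoly.bmnm b != mpoly.mnm0 -> mpoly.bmnm b != n ->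
    forall u v, in_polys b u -> in_polys (mpoly.mnm_sub n b) v -> P t' != u * v.
  apply: filter_forall => b.
  have [bn|bn] := boolP (mpoly.lem b n); last by apply: filterE.
  have [b0|b0] := eqVneq (mpoly.bmnm b) mpoly.mnm0; first by apply: filterE.
  have [b1|b1] := eqVneq (mpoly.bmnm b) n; first by apply: filterE.
  by have := near_not_product cP irP dP Pn bn b0 b1; apply: filterS => t' H _ _ _.
have := near_in_polys_exact cP exP Pn; move: nprod; apply: filterS2 => t' H [Q0 dQ].
split=> //.
  by apply: contra_neqN n0 => /multideg_unit; rewrite dQ.
move=> g h e; have [gu|gu] := boolP (g \is a GRing.unit); first by left.
have [hu|hu] := boolP (h \is a GRing.unit); first by right.
exfalso; move: (Q0); rewrite e mulf_eq0 negb_or => /andP[g0 h0].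
have dgh i : n i = (multideg g i + multideg h i)%N.
  by rewrite -dQ e multidegM// mpoly.mnmDE.
have gn : mpoly.lem (multideg g) n.
  by apply/mpoly.mnm_lepP => i; rewrite dgh leq_addr.
have [b _ be] := expos_mem gn.
have := H b; rewrite be => /(_ gn).
case/(_ _ _ g h _ _)/eqP => //.
- by apply: contraNneq gu => d0; exact: unit_multideg0.
- apply: contraNneq hu => d0; apply: unit_multideg0 => //.
  by apply/mpoly.mnmP => i; have := dgh i; rewrite d0 mpoly.mnm0E; lia.
- exact/in_polysE.
- by apply/in_polysE => i; rewrite mpoly.mnmBE dgh addKn.
Qed.

(** Irreducible polynomials that are not coprime are associated. So they have the
    same degree, and their product is a constant times a square; squares of
    polynomials of bounded degree form a closed set up to constants, which does
    not contain the product of [P1 t] and [P2 t]. *)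
Lemma near_coprime t P1 P2 n1 n2 :
  mcontinuous t P1 -> mcontinuous t P2 ->
  in_polys_exact n1 (P1 t) -> in_polys_exact n2 (P2 t) ->
  irreducible_mpoly (P1 t) -> coprime_mpoly (P1 t) (P2 t) ->
  (forall t', in_polys n1 (P1 t')) -> (forall t', in_polys n2 (P2 t')) ->
  \forall t' \near t, irreducible_mpoly (P1 t') -> irreducible_mpoly (P2 t') ->
     coprime_mpoly (P1 t') (P2 t').
Proof.
move=> c1 c2 ex1 ex2 ir1 cop Pn1 Pn2.
have near1 := near_in_polys_exact c1 ex1 Pn1.
have near2 := near_in_polys_exact c2 ex2 Pn2.
have [eqn|neqn] := eqVneq n1 n2; last first.
  move: near1 near2; apply: filterS2 => t' [Q10 d1] [Q20 d2] ir1' ir2' h h1 h2.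
  apply/negPn/negP => hu; case/eqP: neqn; rewrite -d1 -d2.
  have h0 : h != 0.
    by apply: contra_neq Q10 => h0; have [q ->] := h1; rewrite h0 mul0r.
  have [u uu ->] := irreducible_dvdr ir1' hu h1.
  have [v uv ->] := irreducible_dvdr ir2' hu h2.
  by rewrite !multideg_mul_unit.
subst n2; have [P10 d1] := ex1; have [P20 d2] := ex2.
pose m : multinom l := mpoly.mnm_add n1 n1.
have le_m i : (\sum_(j < 1) 2 * n1 i <= m i)%N.
  by rewrite big_ord1 mpoly.mnmDE; lia.
have fm : in_polys m (P1 t * P2 t).
  by apply/in_polysE => i; rewrite multidegM// d1 d2.
have f0 : P1 t * P2 t != 0 by rewrite mulf_neq0.
have no_square (c : C) (h : 'I_1 -> mpoly l C) : (forall j, in_polys n1 (h j)) ->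
    c *: \prod_j h j ^+ 2 <> P1 t * P2 t.
  move=> hn; rewrite big_ord1; set u := h _ => e.
  have P1prime := irreducible_mpoly_prime ir1.
  have u0 : u != 0.
    by apply: contra_neq f0 => u0; rewrite -e u0 expr0n scaler0.
  have [w ew] : dvdr (P1 t) u.
    have [_ P1u P1M] := P1prime.
    apply: (prime_dvdr_exp (n := 2)) => //.
    have : dvdr (P1 t) (mpoly.mpolyC l c * u ^+ 2).
      by rewrite mpoly.mul_mpolyC e; exact/dvdr_mulr/dvdr_refl.
    case/P1M => // /dvdr_unit; rewrite rmorph_unit ?unitfE; last first.
      by apply: contra_neq f0 => c0; rewrite -e c0 scale0r.
    by move=> /(_ isT) uu; rewrite uu in P1u.
  have w0 : w != 0 by apply: contra_neq u0 => w0; rewrite ew w0 mulr0.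
  have wu : w \is a GRing.unit.
    apply: unit_multideg0 => //; apply/mpoly.mnmP => i; rewrite mpoly.mnm0E.
    have /in_polysE/(_ i) := hn ord0.
    by rewrite -/u ew multidegM// mpoly.mnmDE d1; lia.
  apply: (coprime_irreducible_Ndvd ir1 cop).
  exists (mpoly.mpolyC l c * w ^+ 2); apply: (mulfI P10).
  by rewrite -e ew -mpoly.mul_mpolyC; ring.
have near_m := near_coefvec (mcontinuousM c1 c2)
  (factor_closed (k := fun=> 2%N) (fun=> isT) le_m fm f0 no_square).
 move: near1 near2 near_m; apply: filterS3.
move=> t' [Q10 d1'] [Q20 d2'] H ir1' ir2' h h1 h2.
apply/negPn/negP => hu.
have h0 : h != 0.
  by apply: contra_neq Q10 => h0; have [q ->] := h1; rewrite h0 mul0r.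
have [u uu eu] := irreducible_dvdr ir1' hu h1.
have [v uv ev] := irreducible_dvdr ir2' hu h2.
case: (H (mpoly.mcoeff mpoly.mnm0 (u * v)) (fun=> h)).
  move=> _; apply/in_polysE => i.
  by rewrite -d1' eu multideg_mul_unit.
rewrite big_ord1 -mpoly.mul_mpolyC -multideg0_const; last first.
  by apply: multideg_unit; rewrite unitrM uu.
by rewrite eu ev; congr coefvec; ring.
Qed.

End OpenConditions.

(** * Strict derivatives of polynomial families *)

Section StrictDerivative.
Variables (R : realType) (d : nat).
Local Notation C := (C R).
Implicit Types (f g : 'rV[C]_d -> C) (x h : 'rV[C]_d).

(** The derivative is kept as a function [L], whose linearity is witnessed by the
    column [A], because the formulas for [L] are wanted below. *)
Definition sderiv f x (L : 'rV[C]_d -> C) : Prop :=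
  (exists A : 'cV[C]_d, forall h, L h = (h *m A) 0 0) /\
  forall e : R, 0 < e -> exists2 c : R, 0 < c &
    forall y z, rnorm (y - x) < c -> rnorm (z - x) < c ->
      rnorm (f y - f z - L (y - z)) <= e * rnorm (y - z).

Lemma sderiv_cst (a : C) x : sderiv (fun=> a) x (fun=> 0).
Proof.
split; first by exists 0 => h; rewrite mulmx0 mxE.
move=> e e0; exists 1 => // y z _ _.
by rewrite subrr subr0 rnorm0 mulr_ge0 ?rnorm_ge0// ltW.
Qed.

Lemma sderiv_coord (i : 'I_d) x : sderiv (fun y => y 0 i) x (fun h => h 0 i).
Proof.
split; first by exists (delta_mx i 0) => h; rewrite -colE mxE.
move=> e e0; exists 1 => // y z _ _.
by rewrite !mxE subrr rnorm0 mulr_ge0 ?rnorm_ge0// ltW.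
Qed.

Lemma sderiv_bound f x L : sderiv f x L ->
  exists2 a : R, 0 <= a & forall h, rnorm (L h) <= a * rnorm h.
Proof.
move=> [[A AP] _]; exists (mxbound A) => [|h]; first exact: mxbound_ge0.
by rewrite AP (le_trans (rnorm_coord _ _ _))// rnorm_mulmx.
Qed.

Lemma sderivD f g x Lf Lg : sderiv f x Lf -> sderiv g x Lg ->
  sderiv (fun y => f y + g y) x (fun h => Lf h + Lg h).
Proof.
move=> [[A AP] df] [[B BP] dg]; split.
  by exists (A + B) => h; rewrite AP BP mulmxDr [RHS]mxE.
move=> e e0; have e20 : 0 < e / 2 by rewrite divr_gt0.
have [c1 c10 c1P] := df _ e20; have [c2 c20 c2P] := dg _ e20.
exists (Num.min c1 c2) => [|y z]; first by rewrite lt_min c10.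
rewrite !lt_min => /andP[y1 y2] /andP[z1 z2].
have -> : f y + g y - (f z + g z) - (Lf (y - z) + Lg (y - z)) =
  (f y - f z - Lf (y - z)) + (g y - g z - Lg (y - z)) by ring.
by rewrite (le_trans (rnormD _ _))// [e in leRHS]splitr mulrDl lerD ?c1P ?c2P.
Qed.

Lemma sderivM f g x Lf Lg : sderiv f x Lf -> sderiv g x Lg ->
  sderiv (fun y => f y * g y) x (fun h => f x * Lg h + Lf h * g x).
Proof.
move=> df dg; have [a a0 aP] := sderiv_bound df; have [b b0 bP] := sderiv_bound dg.
have [[A AP] {}df] := df; have [[B BP] {}dg] := dg; split.
  exists (f x *: B + g x *: A) => h; rewrite mulmxDr -!scalemxAr AP BP.
  by rewrite [_ * g x]mulrC [RHS]mxE; congr (_ + _); rewrite [RHS]mxE.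
move=> e e0; pose M := rnorm (f x) + rnorm (g x) + a + b + 2.
have F0 := rnorm_ge0 (f x); have G0 := rnorm_ge0 (g x).
have M0 : 0 < M by rewrite /M; lra.
pose e1 := Num.min 1 (e / M).
have e10 : 0 < e1 by rewrite lt_min ltr01 divr_gt0.
have e11 : e1 <= 1 by rewrite ge_min lexx.
have eM : e1 * M <= e by rewrite -ler_pdivlMr// ge_min lexx orbT.
have [c1 c10 c1P] := df _ e10; have [c2 c20 c2P] := dg _ e10.
pose c := Num.min (Num.min c1 c2) (Num.min (e1 / (a + 1)) (e1 / (b + 1))).
have c0 : 0 < c by rewrite !lt_min c10 c20 !divr_gt0//; lra.
have near_le u (Lu : 'rV[C]_d -> C) cu s y :
    0 <= s -> (forall h, rnorm (Lu h) <= s * rnorm h) ->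
    (forall y z, rnorm (y - x) < cu -> rnorm (z - x) < cu ->
      rnorm (u y - u z - Lu (y - z) : C) <= e1 * rnorm (y - z)) ->
    0 < cu -> rnorm (y - x) < cu -> rnorm (y - x) < e1 / (s + 1) -> rnorm (u y - u x) <= e1.
  move=> s0 sP uP cu0 yc; rewrite ltr_pdivlMr; last lra.
  move=> ys; have xc : rnorm (x - x) < cu by rewrite subrr rnorm0.
  have := uP y x yc xc; have := sP (y - x).
  have := rnormD (u y - u x - Lu (y - x)) (Lu (y - x)); rewrite subrK.
  by have := rnorm_ge0 (y - x); nra.
exists c => // y z; rewrite /c !lt_min.
move=> /andP[/andP[y1 y2] /andP[y3 y4]] /andP[/andP[z1 z2] /andP[z3 z4]].
have fy := near_le _ _ _ _ y a0 aP c1P c10 y1 y3.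
have gz := near_le _ _ _ _ z b0 bP c2P c20 z2 z4.
have := c1P y z y1 z1; have := c2P y z y2 z2.
have := aP (y - z); have := bP (y - z); have := rnorm_ge0 (y - z).
set t := rnorm (y - z); set w := y - z => t0 bt at' dgt dft.
have -> : f y * g y - f z * g z - (f x * Lg w + Lf w * g x) =
  f y * (g y - g z - Lg w) + (f y - f x) * Lg w +
  (f y - f z - Lf w) * g z + Lf w * (g z - g x) by ring.
have nfy : rnorm (f y) <= rnorm (f x) + 1.
  by apply: rnorm_near; exact: le_trans fy e11.
have ngz : rnorm (g z) <= rnorm (g x) + 1.
  by apply: rnorm_near; exact: le_trans gz e11.
have b1 : rnorm (f y * (g y - g z - Lg w)) <= (rnorm (f x) + 1) * (e1 * t).
  by rewrite rnormM ler_pM ?rnorm_ge0.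
have b2 : rnorm ((f y - f x) * Lg w) <= e1 * (b * t) by rewrite rnormM ler_pM ?rnorm_ge0.
have b3 : rnorm ((f y - f z - Lf w) * g z) <= (e1 * t) * (rnorm (g x) + 1).
  by rewrite rnormM ler_pM ?rnorm_ge0.
have b4 : rnorm (Lf w * (g z - g x)) <= (a * t) * e1 by rewrite rnormM ler_pM ?rnorm_ge0.
rewrite (le_trans (rnormD _ _))// (le_trans (lerD (rnormD _ _) (lexx _)))//.
rewrite (le_trans (lerD (lerD (rnormD _ _) (lexx _)) (lexx _)))//.
apply: le_trans (lerD (lerD (lerD b1 b2) b3) b4) _.
apply: le_trans (ler_wpM2r t0 eM); rewrite /M le_eqVlt; apply/orP; left.
by apply/eqP; ring.
Qed.

Lemma sderiv_sum (I : Type) (s : seq I) (p : pred I) (F L : I -> 'rV[C]_d -> C) x :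
  (forall i, sderiv (F i) x (L i)) ->
  sderiv (fun y => \sum_(i <- s | p i) F i y) x (fun h => \sum_(i <- s | p i) L i h).
Proof.
move=> dF; elim: s => [|i s IH].
  under [X in sderiv X]funext do rewrite big_nil.
  under [X in sderiv _ _ X]funext do rewrite big_nil.
  exact: sderiv_cst.
under [X in sderiv X]funext do rewrite big_cons.
under [X in sderiv _ _ X]funext do rewrite big_cons.
by case: (p i) => //; exact: sderivD.
Qed.

Lemma sderiv0_eq0 x L : sderiv (fun=> 0) x L -> forall h, L h = 0.
Proof.
move=> [[A AP] dA] h; rewrite AP.
suff -> : A = 0 by rewrite mulmx0 mxE.
apply: (@has_deriv_unique R d 1 (fun=> 0) x) => e e0; last first.
  exists 1 => // y _; rewrite mulmx0 !subrr rnorm0.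
  by rewrite mulr_ge0 ?rnorm_ge0// ltW.
have [c c0 cP] := dA e e0; exists c => // y yc.
apply: rnorm_mx_le => [|i j]; first by rewrite mulr_ge0 ?rnorm_ge0// ltW.
rewrite (ord1 i) (ord1 j) [X in rnorm X](_ : _ = 0 - 0 - L (y - x)).
  by apply: cP => //; rewrite subrr rnorm0.
by rewrite AP !mxE subrr !sub0r.
Qed.

End StrictDerivative.

Section DualNumbers.
Variables (R : realType) (l d : nat).
Local Notation C := (C R).
Local Notation mcoeff := mpoly.mcoeff.
Implicit Types (P Q : 'rV[C]_d -> mpoly l C) (x : 'rV[C]_d).

(** [D h] stands for the value of the family at [x + 'X * h] modulo ['X ^+ 2]. *)
Definition dual_deriv P x (D : 'rV[C]_d -> {poly mpoly l C}) : Prop :=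
  (forall h, (D h)`_0 = P x) /\
  forall a, sderiv (fun y => mcoeff a (P y)) x (fun h => mcoeff a (D h)`_1).

Lemma dual_derivM P Q x DP DQ : dual_deriv P x DP -> dual_deriv Q x DQ ->
  dual_deriv (fun y => P y * Q y) x (fun h => DP h * DQ h).
Proof.
move=> [P0 dP] [Q0 dQ]; split=> [h|a]; first by rewrite coef0M P0 Q0.
under [X in sderiv X]funext do rewrite mpoly.mcoeffM.
under [X in sderiv _ _ X]funext => h.
  rewrite coef1M P0 Q0 mpoly.mcoeffD !mpoly.mcoeffM -big_split /=.
  over.
by apply: sderiv_sum => i; exact: sderivM.
Qed.

Lemma dual_deriv1 x : dual_deriv (fun=> 1) x (fun=> 1).
Proof.
split=> [h|a]; first by rewrite coef1.
under [X in sderiv _ _ X]funext do rewrite coef1 mpoly.mcoeff0.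
exact: sderiv_cst.
Qed.

Lemma dual_derivX P x DP n : dual_deriv P x DP ->
  dual_deriv (fun y => P y ^+ n) x (fun h => DP h ^+ n).
Proof.
move=> dP; elim: n => [|n IH]; first exact: dual_deriv1.
under [X in dual_deriv X]funext do rewrite exprS.
under [X in dual_deriv _ _ X]funext do rewrite exprS.
exact: dual_derivM.
Qed.

Lemma dual_deriv_prod (I : Type) (s : seq I) F D x :
  (forall i : I, dual_deriv (F i) x (D i)) ->
  dual_deriv (fun y => \prod_(i <- s) F i y) x (fun h => \prod_(i <- s) D i h).
Proof.
move=> dF; elim: s => [|i s IH].
  under [X in dual_deriv X]funext do rewrite big_nil.
  under [X in dual_deriv _ _ X]funext do rewrite big_nil.
  exact: dual_deriv1.
under [X in dual_deriv X]funext do rewrite big_cons.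
under [X in dual_deriv _ _ X]funext do rewrite big_cons.
exact: dual_derivM.
Qed.

Lemma dual_deriv_vecpoly n (v w : 'rV[C]_d -> 'rV[C]_(@dimP l n)) x :
  (forall i, sderiv (fun y => v y 0 i) x (fun h => w h 0 i)) ->
  dual_deriv (fun y => vecpoly (v y)) x
    (fun h => (vecpoly (v x))%:P + (vecpoly (w h))%:P * 'X).
Proof.
move=> dv; split=> [h|a]; first by rewrite coefD coefC coefMX addr0.
under [X in sderiv X]funext do rewrite mcoeff_vecpoly.
under [X in sderiv _ _ X]funext do rewrite coefD coefC coefMX coefC add0r mcoeff_vecpoly.
apply: sderiv_sum => i.
have := sderivM (dv i) (sderiv_cst ((mpoly.bmnm (enum_val i) == a)%:R) x).
by congr sderiv; apply: funext => h; rewrite mulr0 add0r.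
Qed.

Lemma dual_deriv_const (c c' : 'rV[C]_d -> C) x : sderiv c x c' ->
  dual_deriv (fun y => mpoly.mpolyC l (c y)) x
    (fun h => (mpoly.mpolyC l (c x))%:P + (mpoly.mpolyC l (c' h))%:P * 'X).
Proof.
move=> dc; split=> [h|a]; first by rewrite coefD coefC coefMX addr0.
under [X in sderiv X]funext do rewrite mpoly.mcoeffC.
under [X in sderiv _ _ X]funext do rewrite coefD coefC coefMX coefC add0r mpoly.mcoeffC.
have := sderivM dc (sderiv_cst ((a == mpoly.mnm0)%:R) x).
by congr sderiv; apply: funext => h; rewrite mulr0 add0r.
Qed.

Lemma finite_min (I : finType) (c : I -> R) : (forall i, 0 < c i) ->
  exists2 e : R, 0 < e & forall i, e <= c i.
Proof.
move=> c0; exists (\big[Num.min/1]_i c i); last by move=> i; exact: bigmin_le_cond.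
by apply/bigmin_gtP.
Qed.

(** A vector of the kernel kills the derivatives of the coefficients that [coefvec n]
    retains; the other coefficients are constantly zero. *)
Lemma dual_deriv_strict n P x D : dual_deriv P x D ->
  (forall y, in_polys n (P y)) ->
  exists2 A : 'M[C]_(d, dimP n), strict_deriv (fun y => coefvec n (P y)) x A &
    forall h, h *m A = 0 -> (D h)`_1 = 0.
Proof.
move=> [D0 dD] Pn.
have [B BP] : exists B : 'I_(dimP n) -> 'cV[C]_d,
    forall i h, mcoeff (mpoly.bmnm (enum_val i)) (D h)`_1 = (h *m B i) 0 0.
  apply: (fin_all_exists (P := fun i B =>
    forall h, mcoeff (mpoly.bmnm (enum_val i)) (D h)`_1 = (h *m B) 0 0)) => i.
  by case: (dD (mpoly.bmnm (enum_val i))).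
pose A := \matrix_(p, i) B i p 0.
have AE h i : (h *m A) 0 i = mcoeff (mpoly.bmnm (enum_val i)) (D h)`_1.
  by rewrite BP !mxE; apply: eq_bigr => j _; rewrite mxE.
exists A.
  move=> e e0.
  have [c cP] : exists c : 'I_(dimP n) -> R, forall i, 0 < c i /\
      forall y z, rnorm (y - x) < c i -> rnorm (z - x) < c i ->
      rnorm (mcoeff (mpoly.bmnm (enum_val i)) (P y) - mcoeff (mpoly.bmnm (enum_val i)) (P z)
        - mcoeff (mpoly.bmnm (enum_val i)) (D (y - z))`_1) <= e * rnorm (y - z).
    apply: (fin_all_exists (P := fun i c => 0 < c /\ forall y z, rnorm (y - x) < c ->
      rnorm (z - x) < c ->
      rnorm (mcoeff (mpoly.bmnm (enum_val i)) (P y) - mcoeff (mpoly.bmnm (enum_val i)) (P z)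
        - mcoeff (mpoly.bmnm (enum_val i)) (D (y - z))`_1) <= e * rnorm (y - z))) => i.
    by case: (dD (mpoly.bmnm (enum_val i))) => _ /(_ e e0)[c c0 cP]; exists c.
  have [c0 c00 c0P] := finite_min (fun i => (cP i).1).
  exists c0 => // y z yc zc; apply: rnorm_mx_le.
    by rewrite mulr_ge0 ?rnorm_ge0// ltW.
  move=> i j; rewrite (ord1 i).
  have := (cP j).2 y z (lt_le_trans yc (c0P j)) (lt_le_trans zc (c0P j)).
  by rewrite -AE !mxE.
move=> h hA; apply/mpoly.mpolyP => a; rewrite mpoly.mcoeff0.
have [an|an] := boolP (mpoly.lem a n).
  have [b bn <-] := expos_mem an.
  have := AE h (enum_rank_in bn b); rewrite hA mxE enum_rankK_in//.
have : sderiv (fun=> 0) x (fun h => mcoeff a (D h)`_1).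
  have := dD a; congr sderiv; apply: funext => y; exact: mcoeff_out (Pn y) an.
by move/sderiv0_eq0.
Qed.

End DualNumbers.

(** * The space of normalised factorizations *)

Section Slice.
Variables (R : realType) (l r : nat).
Local Notation C := (C R).
Local Notation mcoeff := mpoly.mcoeff.
Variables (md : 'I_r -> multinom l) (k : 'I_r -> nat) (m : multinom l).
Variable i0 : forall j, 'I_(dimP (md j)).


(** [i0 j] is the place of the coefficient of the factor [j] that is fixed to 1. The
    parameters are indexed by the other coefficients of all the factors, and by
    [None] for the constant. *)
Definition coef_index : finType := {j : 'I_r & 'I_(dimP (md j))}.

Definition free_index : finType := {u : coef_index | tagged u != i0 (tag u)}.

Definition slice_dim : nat := #|{: option free_index}|.

Definition slot j (i : 'I_(dimP (md j))) : option 'I_slice_dim :=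
  omap (fun u : free_index => enum_rank (Some u))
       (insub (Tagged (fun j => 'I_(dimP (md j))) i)).

Definition scale_slot : 'I_slice_dim := enum_rank None.

Definition slice_factor (x : 'rV[C]_slice_dim) j : 'rV[C]_(dimP (md j)) :=
  \row_i if slot i is Some s then x 0 s else 1.

(** The derivative of [slice_factor]: the fixed coefficients do not vary. *)
Definition slice_variation (h : 'rV[C]_slice_dim) j : 'rV[C]_(dimP (md j)) :=
  \row_i if slot i is Some s then h 0 s else 0.

Definition slice_product (x : 'rV[C]_slice_dim) : mpoly l C :=
  x 0 scale_slot *: \prod_j vecpoly (slice_factor x j) ^+ k j.

Definition slice_point (c : C) (v : forall j, 'rV[C]_(dimP (md j))) : 'rV[C]_slice_dim :=
  \row_s if enum_val s is Some u then v (tag (val u)) 0 (tagged (val u)) else c.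

Lemma slot_i0 j : slot (i0 j) = None.
Proof. by rewrite /slot insubN//= negbK. Qed.

Lemma slot_neq j (i : 'I_(dimP (md j))) (ni : i != i0 j) :
  slot i = Some (enum_rank (Some (Sub (Tagged (fun j => 'I_(dimP (md j))) i) ni : free_index))).
Proof. by rewrite /slot insubT. Qed.

Lemma slice_point_scale (c : C) (v : forall j, 'rV[C]_(dimP (md j))) :
  slice_point c v 0 scale_slot = c.
Proof. by rewrite mxE enum_rankK. Qed.

Lemma slice_pointK (c : C) (v : forall j, 'rV[C]_(dimP (md j))) j :
  v j 0 (i0 j) = 1 -> slice_factor (slice_point c v) j = v j.
Proof.
move=> v1; apply/rowP => i; rewrite mxE.
have [->|ni] := eqVneq i (i0 j); first by rewrite slot_i0.
by rewrite (slot_neq ni) mxE enum_rankK.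
Qed.

Lemma slice_variation_i0 (h : 'rV[C]_slice_dim) j : slice_variation h j 0 (i0 j) = 0.
Proof. by rewrite mxE slot_i0. Qed.

Lemma slice_factor_i0 (x : 'rV[C]_slice_dim) j : slice_factor x j 0 (i0 j) = 1.
Proof. by rewrite mxE slot_i0. Qed.

Lemma slice_variation_eq0 (h : 'rV[C]_slice_dim) : h 0 scale_slot = 0 ->
  (forall j, slice_variation h j = 0) -> h = 0.
Proof.
move=> h0 hv; apply/rowP => s; rewrite [RHS]mxE -(enum_valK s).
case: (enum_val s) => [[[j i] /= ni]|//].
by have := congr1 (fun v : 'rV[C]_(dimP (md j)) => v 0 i) (hv j); rewrite !mxE (slot_neq ni).
Qed.

Lemma slice_dimE : (slice_dim%:Z = \sum_j (dimP (md j))%:Z + 1 - r%:Z)%R.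
Proof.
have -> : (\sum_j (dimP (md j))%:Z + 1 - r%:Z = \sum_j (dimP (md j)).-1%:Z + 1)%R.
  have -> : r%:Z = \sum_(j < r) 1 :> int by rewrite sumr_const card_ord -[LHS]natz.
  rewrite addrAC -sumrB; congr (_ + 1); apply: eq_bigr => j _.
  have : (0 < dimP (md j))%N by apply: leq_ltn_trans (ltn_ord (i0 j)).
  lia.
rewrite /slice_dim card_option card_sig -sum1_card.
rewrite (eq_bigl (fun u : coef_index => tagged u != i0 (tag u))) => [|u]; last first.
  by rewrite !inE.
rewrite -(sig_big_dep (fun=> true) (fun j i => i != i0 j) (fun _ _ => 1%N)) /=.
rewrite -addn1 PoszD; congr (_ + _).
rewrite (big_morph Posz PoszD erefl); apply: eq_bigr => j _.
rewrite sum1dep_card; have := cardC1 (i0 j); rewrite card_ord => <-.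
by congr Posz; apply: eq_card => i; rewrite !inE.
Qed.

Lemma slice_factor_mcontinuous j (x : 'rV[C]_slice_dim) :
  mcontinuous x (fun x => vecpoly (slice_factor x j)).
Proof.
apply: vecpoly_continuous; apply: continuous_rV_at => i.
under [X in {for _, continuous X}]funext do rewrite mxE.
case: (slot i) => [s|]; last exact: cst_continuous.
exact: coord_continuous.
Qed.

Lemma slice_product_deriv (x : 'rV[C]_slice_dim) : dual_deriv slice_product x (fun h =>
  ((mpoly.mpolyC l (x 0 scale_slot))%:P + (mpoly.mpolyC l (h 0 scale_slot))%:P * 'X) *
  \prod_j ((vecpoly (slice_factor x j))%:P + (vecpoly (slice_variation h j))%:P * 'X) ^+ k j).
Proof.
rewrite /slice_product; under [X in dual_deriv X]funext do rewrite -mpoly.mul_mpolyC.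
apply: dual_derivM; first exact: dual_deriv_const (sderiv_coord _ _).
apply: dual_deriv_prod => j; apply: dual_derivX; apply: dual_deriv_vecpoly => i.
under [X in sderiv X]funext do rewrite mxE.
under [X in sderiv _ _ X]funext do rewrite mxE.
by case: (slot i) => [s|]; [exact: sderiv_coord|exact: sderiv_cst].
Qed.

Hypothesis k0 : forall j, (0 < k j)%N.
Hypothesis mE : forall i, m i = (\sum_j k j * md j i)%N.

Lemma slice_product_in x : in_polys m (slice_product x).
Proof.
apply: (in_polys_prod_exp (n := md)) => // [i|j]; first by rewrite mE.
exact: vecpoly_in.
Qed.

Lemma slice_immersion (x : 'rV[C]_slice_dim) :
  x 0 scale_slot != 0 ->
  (forall j, in_polys_exact (md j) (vecpoly (slice_factor x j))) ->
  (forall j, irreducible_mpoly (vecpoly (slice_factor x j))) ->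
  (forall i j, i != j -> coprime_mpoly (vecpoly (slice_factor x i)) (vecpoly (slice_factor x j))) ->
  exists2 A, strict_deriv (coefvec m \o slice_product) x A & row_free A.
Proof.
move=> x0 ex irr cop.
have [A dA Ainj] := dual_deriv_strict (slice_product_deriv x) slice_product_in.
exists A => //; apply: inj_row_free => h /Ainj e.
have [] := @dual_kernel C l r (fun j => vecpoly (slice_factor x j))
  (fun j => vecpoly (slice_variation h j)) k
  (fun j => mpoly.bmnm (enum_val (i0 j))) (x 0 scale_slot) (h 0 scale_slot) _ irr cop k0 x0 _ _ _ e.
- exact: pchar_num.
- by move=> j; rewrite (ex j).2; exact: vecpoly_in.
- move=> j; have := congr1 (fun v : 'rV[C]_(dimP (md j)) => v 0 (i0 j)) (vecpolyK (slice_factor x j)).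
  by rewrite mxE slice_factor_i0 => ->; rewrite oner_eq0.
- move=> j; have := congr1 (fun v : 'rV[C]_(dimP (md j)) => v 0 (i0 j)) (vecpolyK (slice_variation h j)).
  by rewrite mxE slice_variation_i0.
move=> h0 hv; apply: slice_variation_eq0 => // j.
by rewrite -[LHS]vecpolyK hv; apply/rowP => i; rewrite !mxE mpoly.mcoeff0.
Qed.

Definition slice_regular (x : 'rV[C]_slice_dim) : Prop :=
  [/\ x 0 scale_slot != 0,
      forall j, in_polys_exact (md j) (vecpoly (slice_factor x j)),
      forall j, irreducible_mpoly (vecpoly (slice_factor x j)) &
      forall i j, i != j ->
        coprime_mpoly (vecpoly (slice_factor x i)) (vecpoly (slice_factor x j))].

Lemma near_slice_regular x : slice_regular x -> \forall y \near x, slice_regular y.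
Proof.
move=> [x0 ex irr cop].
have nx0 : \forall y \near x, (y : 'rV[C]_slice_dim) 0 scale_slot != 0.
  apply/nbhs_rnormP; exists (rnorm (x 0 scale_slot)).
    by rewrite lt_def rnorm_eq0 x0 rnorm_ge0.
  move=> y yx; apply: contraTneq yx => y0; rewrite -leNgt.
  have := rnorm_coord (y - x) 0 scale_slot.
  by rewrite !mxE y0 sub0r rnormN.
have nex : \forall y \near x, forall j, in_polys_exact (md j) (vecpoly (slice_factor y j)).
  apply: (@filter_forall _ _ (fun j y =>
    in_polys_exact (md j) (vecpoly (slice_factor y j))) (nbhs x) _) => j.
  exact: (near_in_polys_exact (@slice_factor_mcontinuous j x) (ex j)
    (fun y => vecpoly_in _)).
have nirr : \forall y \near x, forall j, irreducible_mpoly (vecpoly (slice_factor y j)).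
  apply: (@filter_forall _ _ (fun j y =>
    irreducible_mpoly (vecpoly (slice_factor y j))) (nbhs x) _) => j.
  exact: (near_irreducible (@slice_factor_mcontinuous j x) (ex j) (irr j)
    (fun y => vecpoly_in _)).
have ncop : \forall y \near x, forall ij : 'I_r * 'I_r, ij.1 != ij.2 ->
    irreducible_mpoly (vecpoly (slice_factor y ij.1)) ->
    irreducible_mpoly (vecpoly (slice_factor y ij.2)) ->
    coprime_mpoly (vecpoly (slice_factor y ij.1)) (vecpoly (slice_factor y ij.2)).
  apply: (@filter_forall _ _ (fun ij y => ij.1 != ij.2 ->
    irreducible_mpoly (vecpoly (slice_factor y ij.1)) ->
    irreducible_mpoly (vecpoly (slice_factor y ij.2)) ->
    coprime_mpoly (vecpoly (slice_factor y ij.1)) (vecpoly (slice_factor y ij.2)))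
    (nbhs x) _) => -[i j] /=.
  have [->|nij] := eqVneq i j; first by apply: (@filterE _ (nbhs x) _) => y.
  have := near_coprime (@slice_factor_mcontinuous i x) (@slice_factor_mcontinuous j x)
    (ex i) (ex j) (irr i) (cop _ _ nij) (fun y => vecpoly_in _) (fun y => vecpoly_in _).
  by apply: filterS => y H _; exact: H.
have near_all := [elaborate filterI (filterI nx0 nex) (filterI nirr ncop)].
refine (@filterS _ (nbhs x) _ _ _ _ near_all) => y [[y0 yex] [yirr ycop]].
split; [exact: y0|exact: yex|exact: yirr|move=> i j nij].
exact: (ycop (i, j) nij (yirr i) (yirr j)).
Qed.

Lemma slice_regular_fact_set x : slice_regular x -> fact_set C m md k (slice_product x).
Proof.
move=> [x0 ex irr cop]; split; last first.
  by exists (x 0 scale_slot), (fun j => vecpoly (slice_factor x j)).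
have g0 j : vecpoly (slice_factor x j) != 0 by case: (ex j).
split; first by rewrite scaler_eq0 negb_or x0; apply/prodf_neq0 => j _; exact: expf_neq0.
apply/mpoly.mnmP => i; rewrite mE multideg_prod_exp//.
by apply: eq_bigr => j _; rewrite (ex j).2.
Qed.

End Slice.

Lemma irreducible_mul_unit (K : fieldType) l (f u : mpoly l K) :
  u \is a GRing.unit -> irreducible_mpoly f -> irreducible_mpoly (f * u).
Proof.
move=> uu /irreducible_mpoly_prime fP.
exact: prime_irreducible (prime_assoc uu fP).
Qed.

Lemma coprime_mul_unit (K : fieldType) l (f g u v : mpoly l K) :
  u \is a GRing.unit -> v \is a GRing.unit ->
  coprime_mpoly f g -> coprime_mpoly (f * u) (g * v).
Proof.
move=> uu uv cop h [f' ef] [g' eg]; apply: cop.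
  by exists (f' * u^-1); rewrite mulrA -ef mulrK.
by exists (g' * v^-1); rewrite mulrA -eg mulrK.
Qed.

Section SliceCaptures.
Variables (R : realType) (l r : nat).
Local Notation C := (C R).
Local Notation mcoeff := mpoly.mcoeff.
Variables (md : 'I_r -> multinom l) (k : 'I_r -> nat) (m : multinom l).
Variable i0 : forall j, 'I_(dimP (md j)).
Hypothesis k0 : forall j, (0 < k j)%N.
Hypothesis mE : forall i, m i = (\sum_j k j * md j i)%N.

Lemma slice_point_eta (x : 'rV[C]_(slice_dim i0)) :
  slice_point i0 (x 0 (scale_slot i0)) (slice_factor x) = x.
Proof.
apply/rowP => s; rewrite mxE -{2}(enum_valK s).
case: (enum_val s) => [[[j i] /= ni]|//].
by rewrite mxE (slot_neq ni); congr (x 0 (enum_rank (Some _))).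
Qed.

Lemma mcoeff_slice_factor (x : 'rV[C]_(slice_dim i0)) j :
  mcoeff (mpoly.bmnm (enum_val (i0 j))) (vecpoly (slice_factor x j)) = 1.
Proof.
have := congr1 (fun v : 'rV[C]_(dimP (md j)) => v 0 (i0 j)) (vecpolyK (slice_factor x j)).
by rewrite mxE slice_factor_i0.
Qed.

Section Renormalize.
Variables (p : factor_space R md) (s s' : 'I_r -> 'I_r).
Hypotheses (sK : cancel s s') (sK' : cancel s' s).
Hypothesis (ks : forall j, k (s j) = k j) (mds : forall j, md (s j) = md j).

Let b i := mpoly.bmnm (enum_val (i0 i)).
Let H (q : factor_space R md) i : mpoly l C := vecpoly (factor_coefs q (s' i)).
Let e q i : C := mcoeff (b i) (H q i).

(** When the factors of [q] match those of a normalised factorization up to [s] and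
    to constants, this brings them to the right places and moves the constants
    into [alpha]. *)
Definition renormalize (q : factor_space R md) : 'rV[C]_(slice_dim i0) :=
  slice_point i0 (q.1 * \prod_i e q i ^+ k i)
    (fun i => coefvec (md i) ((e q i)^-1 *: H q i)).

Lemma prod_reindex (F : 'I_r -> mpoly l C) :
  \prod_i F (s' i) ^+ k i = \prod_j F j ^+ k j.
Proof.
rewrite (reindex_inj (can_inj sK)) /=; apply: eq_bigr => j _.
by rewrite sK ks.
Qed.

Lemma slice_product_renormalize q : (forall i, e q i != 0) ->
  slice_product k (renormalize q) = expansion k q.
Proof.
move=> e0; have vE i : vecpoly (slice_factor (renormalize q) i) = (e q i)^-1 *: H q i.
  rewrite slice_pointK; last first.
    by rewrite mxE mpoly.mcoeffZ mulVf.
  rewrite coefvecK//; apply: in_polysZ; rewrite -(sK' i) mds sK'; exact: vecpoly_in.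
rewrite /slice_product; under eq_bigr do rewrite vE exprZn.
rewrite slice_point_scale scaler_prod scalerA -mulrA -big_split /= big1 ?mulr1; last first.
  by move=> i _; rewrite -exprMn divff// expr1n.
by congr (_ *: _); exact: (prod_reindex (fun j => vecpoly (factor_coefs q j))).
Qed.

Lemma sorted_factor_mcontinuous i : mcontinuous p (fun q => H q i).
Proof. exact: (vecpoly_continuous (@factor_coefs_continuous R l r md (s' i) p)). Qed.

Lemma renormalize_continuous : (forall i, e p i != 0) ->
  {for p, continuous renormalize}.
Proof.
move=> e0; apply: continuous_rV_at => t.
case et : (enum_val t) => [u|].
  pose i := tag (val u); pose a := mpoly.bmnm (enum_val (tagged (val u))).
  have -> : (fun q => renormalize q 0 t) = (fun q => (e q i)^-1 * mcoeff a (H q i)).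
    by apply: funext => q; rewrite mxE et mxE mpoly.mcoeffZ.
  apply: continuous_mul_at; last exact: sorted_factor_mcontinuous.
  exact: (continuousV (e0 _) (@sorted_factor_mcontinuous _ _)).
have -> : (fun q => renormalize q 0 t) = (fun q => q.1 * \prod_i e q i ^+ k i).
  by apply: funext => q; rewrite mxE et.
apply: continuous_mul_at; first exact: cvg_fst.
apply: continuous_prod_at => i; apply: continuous_exp_at; exact: sorted_factor_mcontinuous.
Qed.

End Renormalize.

(** By [factor_match] any expression [p] of [slice_product k x] as a product of norm-1
    factors is sorted and normalised to [x] itself. Sorting and normalising is
    continuous, so that it sends a neighbourhood of [p] into [U]; thus
    [factor_limit] applies. *)
Lemma slice_captures (x : 'rV[C]_(slice_dim i0)) (U : set 'rV[C]_(slice_dim i0)) :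
  slice_regular x -> nbhs x U ->
  \forall w \near coefvec m (slice_product k x), forall f,
    fact_set C m md k f -> coefvec m f = w ->
    exists2 y, U y & slice_product k y = f.
Proof.
move=> gx nU; have [x0 ex irr cop] := gx.
have [[f0 df] _] := slice_regular_fact_set mE gx.
pose Q : set (factor_space R md) := [set p | exists2 y, U y & slice_product k y = expansion k p].
have le_m i : (\sum_j k j * md j i <= m i)%N by rewrite mE.
have HQ p : sphere_factors p.2 -> expansion k p = slice_product k x -> nbhs p Q.
  move=> _ ep; pose g j := vecpoly (slice_factor x j).
  have [s s_inj sP] := factor_match irr cop k0 (fun j => (ex j).2)
    (fun j => vecpoly_in (factor_coefs p j)) x0 (esym ep).
  have [s' sK sK'] := injF_bij s_inj.
  have [c cP] : exists c : 'I_r -> C, forall j, c j != 0 /\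
      vecpoly (factor_coefs p j) = c j *: g (s j).
    apply: (fin_all_exists (P := fun j c => c != 0 /\
      vecpoly (factor_coefs p j) = c *: g (s j))) => j.
    by have [_ _ [c c0 e]] := sP j; exists c; split; [exact: c0|exact: e].
  have ks j : k (s j) = k j by case: (sP j).
  have mds j : md (s j) = md j by case: (sP j).
  have eE i : mcoeff (mpoly.bmnm (enum_val (i0 i))) (vecpoly (factor_coefs p (s' i))) = c (s' i).
    by rewrite (cP (s' i)).2 mpoly.mcoeffZ sK' mcoeff_slice_factor mulr1.
  have e0 i : mcoeff (mpoly.bmnm (enum_val (i0 i))) (vecpoly (factor_coefs p (s' i))) != 0.
    by rewrite eE; case: (cP (s' i)).
  have px : renormalize s' p = x.
    rewrite -[RHS]slice_point_eta /renormalize; congr slice_point.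
      under eq_bigr do rewrite eE.
      rewrite (reindex_inj s_inj) /=; under eq_bigr do rewrite sK ks.
      have : \prod_j g j ^+ k j != 0.
        by apply/prodf_neq0 => j _; apply: expf_neq0; case: (ex j).
      have hE j : vecpoly (factor_coefs p j) = c j *: g (s j) by exact: (cP j).2.
      move: ep; rewrite /expansion (eq_bigr (fun j => c j ^+ k j *: g (s j) ^+ k j));
        last by move=> j _; rewrite hE exprZn.
      rewrite scaler_prod scalerA.
      have -> : \prod_j g (s j) ^+ k j = \prod_j g j ^+ k j.
        by rewrite [RHS](reindex_inj s_inj) /=; apply: eq_bigr => j _; rewrite ks.
      move/eqP; rewrite -subr_eq0 -scalerBl scaler_eq0 => /orP[/eqP/subr0_eq//|].
      by move=> /eqP -> /eqP.
    apply: functional_extensionality_dep => i.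
    rewrite eE (cP (s' i)).2 scalerA mulVf; last by case: (cP (s' i)).
    by rewrite scale1r sK'; exact: vecpolyK.
  have cR := renormalize_continuous e0.
  have nUR : \forall q \near p, U (renormalize s' q).
    by apply: cR; rewrite px.
  have ne : \forall q \near p, forall i,
      mcoeff (mpoly.bmnm (enum_val (i0 i))) (vecpoly (factor_coefs q (s' i))) != 0.
    apply: (@filter_forall _ _ (fun i q =>
      mcoeff (mpoly.bmnm (enum_val (i0 i))) (vecpoly (factor_coefs q (s' i))) != 0) (nbhs p) _) => i.
    exact: (near_mcoeff_neq0 (@sorted_factor_mcontinuous p s' i) (e0 i)).
  have near_all := [elaborate filterI nUR ne].
  refine (@filterS _ (nbhs p) _ _ _ _ near_all) => q [Uq eq].
  exists (renormalize s' q); first exact: Uq.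
  exact: (slice_product_renormalize sK sK' ks mds eq).
have fm : in_polys m (slice_product k x) by exact: slice_product_in.
have near_w := factor_limit k0 le_m fm f0 HQ.
refine (@filterS _ _ _ _ _ _ near_w) => w Hw f [_ [c [h [hex _ _ ->]]]] ew.
have [|p [y Uy ey] ep] := Hw c h _ ew.
  by move=> j; rewrite /in_polys (hex j).2; apply/mpoly.mnm_lepP.
exists y; [exact: Uy|exact: etrans ey ep].
Qed.

Lemma normalized_factorization (f : mpoly l C) :
  fact_set C m md k f ->
  exists (i0 : forall j, 'I_(dimP (md j))) (x : 'rV[C]_(slice_dim i0)),
    slice_regular x /\ slice_product k x = f.
Proof.
move=> [[f0 _] [c [g [gex girr gcop ef]]]].
have gin j : in_polys (md j) (g j).
  by rewrite /in_polys (gex j).2; apply/mpoly.mnm_lepP.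
have [a aP] : exists a : forall j, 'I_(dimP (md j)),
    forall j, coefvec (md j) (g j) 0 (a j) != 0.
  apply: (fin_all_exists (P := fun j a => coefvec (md j) (g j) 0 a != 0)) => j.
  apply: contrapT => H; case: (gex j) => /negP[]; apply/eqP.
  apply: (coefvec_eq0 (gin j)); apply/rowP => i; rewrite [RHS]mxE; apply/eqP/negPn/negP => ni.
  by apply: H; exists i.
pose b j := coefvec (md j) (g j) 0 (a j).
have bu j : mpoly.mpolyC l (b j)^-1 \is a GRing.unit.
  by rewrite rmorph_unit// unitfE invr_eq0; exact: aP.
pose v j := (b j)^-1 *: coefvec (md j) (g j).
have vE j : vecpoly (v j) = g j * mpoly.mpolyC l (b j)^-1.
  by rewrite vecpolyZ coefvecK// mulrC mpoly.mul_mpolyC.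
pose x : 'rV[C]_(slice_dim a) := slice_point a (c * \prod_j b j ^+ k j) v.
have sE j : slice_factor x j = v j.
  by apply: slice_pointK; rewrite mxE mulVf//; exact: aP.
exists a, x; split; last first.
  rewrite /slice_product; under eq_bigr do rewrite sE vecpolyZ (coefvecK (gin _)) exprZn.
  rewrite slice_point_scale scaler_prod scalerA -mulrA -big_split /= big1 ?mulr1// => j _.
  by rewrite -exprMn divff ?expr1n//; exact: aP.
split.
- rewrite slice_point_scale mulf_neq0//.
    by apply: contra_neq f0 => c0; rewrite ef c0 scale0r.
  by apply/prodf_neq0 => j _; apply: expf_neq0; exact: aP.
- move=> j; rewrite sE vE; have [g0 dg] := gex j; split.
    by rewrite mulf_neq0//; apply: contraTneq (bu j) => ->; rewrite unitr0.
  by rewrite multideg_mul_unit.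
- by move=> j; rewrite sE vE; exact: irreducible_mul_unit.
- by move=> i j nij; rewrite !sE !vE; apply: coprime_mul_unit => //; exact: gcop.
Qed.

End SliceCaptures.

(** * Charts and their dimension *)

Section Charts.
Variables (R : realType) (l : nat).
Local Notation C := (C R).
Implicit Types (m : multinom l) (S : set (mpoly l C)).

Lemma polynorm_ge0 m (f : mpoly l C) : 0 <= polynorm m f.
Proof. by rewrite sqrtC_ge0 sumr_ge0// => i _; rewrite exprn_ge0. Qed.

Lemma rnorm_coefvec_le m (f : mpoly l C) : (rnorm (coefvec m f))%:C <= polynorm m f.
Proof.
have pr : polynorm m f = (complex.Re (polynorm m f : R[i]))%:C :> R[i].
  by rewrite RRe_real// realE polynorm_ge0.
rewrite pr lecR; apply: rnorm_mx_le => [|i j].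
  by rewrite -lecR -pr; exact: polynorm_ge0.
rewrite -lecR -rnormE -pr (ord1 i).
have -> : `|coefvec m f 0 j| = sqrtC (`|coefvec m f 0 j| ^+ 2) :> C by rewrite sqrCK.
rewrite ler_sqrtC ?nnegrE ?exprn_ge0//; last by rewrite sumr_ge0// => s _; rewrite exprn_ge0.
by rewrite (bigD1 j)//= lerDl sumr_ge0// => s _; rewrite exprn_ge0.
Qed.

Lemma polynorm_le m (f : mpoly l C) :
  polynorm m f <= ((dimP m)%:R * rnorm (coefvec m f))%:C.
Proof.
set M := rnorm (coefvec m f); have M0 : 0 <= M by exact: rnorm_ge0.
have NM0 : 0 <= (((dimP m)%:R * M)%:C : C) by rewrite lecR mulr_ge0.
rewrite -[leRHS](sqrCK NM0) ler_sqrtC ?nnegrE ?exprn_ge0//; last first.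
  by rewrite sumr_ge0// => s _; rewrite exprn_ge0.
have -> : (((dimP m)%:R * M)%:C : C) ^+ 2 = (((dimP m)%:R * M) ^+ 2)%:C.
  by rewrite rmorphXn.
apply: (@le_trans _ _ (\sum_(i < dimP m) ((M ^+ 2)%:C : C))).
  apply: ler_sum => i _; rewrite (rnormE (coefvec m f 0 i)) -rmorphXn lecR.
  by rewrite lerXn2r ?nnegrE ?rnorm_ge0// rnorm_coord.
rewrite -rmorph_sum lecR sumr_const card_ord exprMn -[leLHS]mulr_natl.
rewrite ler_wpM2r ?exprn_ge0// -natrX ler_nat.
by case: (dimP m) => // N; rewrite expnS expn1 leq_pmulr.
Qed.

Lemma open_coefvec_ball m (f : mpoly l C) (c : R) :
  open_in_polys m [set q | in_polys m q /\ rnorm (coefvec m q - coefvec m f) < c].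
Proof.
split=> [q []//|p [pm pc]].
exists (c - rnorm (coefvec m p - coefvec m f))%:C; first by rewrite ltcR subr_gt0.
move=> q qm qp; split=> //.
have := le_lt_trans (rnorm_coefvec_le m (q - p)) qp; rewrite ltcR.
have -> : coefvec m (q - p) = coefvec m q - coefvec m p.
  by apply/rowP => i; rewrite !mxE mpoly.mcoeffB.
have := rnorm_tri (coefvec m q) (coefvec m p) (coefvec m f); lra.
Qed.

Lemma open_in_polys_ball m (Omega : set (mpoly l C)) p :
  open_in_polys m Omega -> Omega p -> exists2 c : R, 0 < c &
    forall q, in_polys m q -> rnorm (coefvec m q - coefvec m p) < c -> Omega q.
Proof.
move=> [_ +] Op => /(_ p Op)[e e0 eP].
have er : e = (complex.Re (e : R[i]))%:C :> R[i] by rewrite RRe_real// realE (ltW e0).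
set e' := complex.Re (e : R[i]) in er.
have e'0 : 0 < e' by rewrite -ltcR -er.
have N1 : 0 < (dimP m)%:R + 1 :> R by rewrite ltr_wpDl.
exists (e' / ((dimP m)%:R + 1)); first by rewrite divr_gt0.
move=> q qm; rewrite ltr_pdivlMr// => qp; apply: eP => //.
apply: le_lt_trans (polynorm_le _ _) _; rewrite er ltcR.
have -> : coefvec m (q - p) = coefvec m q - coefvec m p.
  by apply/rowP => i; rewrite !mxE mpoly.mcoeffB.
apply: le_lt_trans qp; rewrite mulrC ler_wpM2l ?rnorm_ge0//; lra.
Qed.

(** The change of charts [u] and its inverse [w] extend to maps that are
    differentiable at the images of [p]. By the chain rule their derivatives [A]
    and [B] satisfy [A *m B = 1]. *)
Lemma chart_dim_le m S p d1 d2 : S `<=` in_polys m -> S p ->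
  (exists Omega (V : set 'rV[C]_d1) (phi : 'rV[C]_(dimP m) -> 'rV[C]_d1),
    [/\ open_in_polys m Omega, Omega p, open V &
        biholomorphic (coefvec m @` (S `&` Omega)) V phi]) ->
  (exists Omega (V : set 'rV[C]_d2) (phi : 'rV[C]_(dimP m) -> 'rV[C]_d2),
    [/\ open_in_polys m Omega, Omega p, open V &
        biholomorphic (coefvec m @` (S `&` Omega)) V phi]) ->
  (d1 <= d2)%N.
Proof.
move=> Sm Sp [Om1 [V1 [phi1 [opOm1 Om1p oV1 [bij1 ext1 [psi1 [[_ dpsi1] can1]]]]]]].
move=> [Om2 [V2 [phi2 [opOm2 Om2p oV2 [bij2 ext2 [psi2 [[_ dpsi2] can2]]]]]]].
set a := coefvec m p.
have A1a : (coefvec m @` (S `&` Om1)) a by exists p.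
have A2a : (coefvec m @` (S `&` Om2)) a by exists p.
have [fun1 _ surj1] := bij1; have [fun2 _ surj2] := bij2.
have [U1 [Phi1 [U1a [oU1 dPhi1] e1]]] := ext1 a A1a.
have [U2 [Phi2 [U2a [oU2 dPhi2] e2]]] := ext2 a A2a.
have V1a := fun1 _ A1a; have V2a := fun2 _ A2a.
have psi1a : psi1 (phi1 a) = a by apply: can1; rewrite inE.
have psi2a : psi2 (phi2 a) = a by apply: can2; rewrite inE.
have Phi2a : Phi2 a = phi2 a by apply: e2; rewrite inE.
pose u := Phi2 \o psi1; pose w := Phi1 \o psi2.
have ua : u (phi1 a) = phi2 a by rewrite /u /= psi1a.
have du : differentiable u (phi1 a).
  by apply: differentiable_comp; [exact: dpsi1|rewrite psi1a; exact: dPhi2].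
have dw : differentiable w (u (phi1 a)).
  rewrite ua; apply: differentiable_comp; first exact: dpsi2.
  by rewrite psi2a; exact: dPhi1.
have [A dA] := (differentiable_rnormP _ _).1 du.
have [B dB] := (differentiable_rnormP _ _).1 dw.
have [c c0 cP] := open_in_polys_ball opOm2 Om2p.
have cpsi1 : {for phi1 a, continuous psi1}.
  by apply: differentiable_continuous; exact: dpsi1.
have n1 : \forall v \near phi1 a, V1 v by exact: open_nbhs_nbhs.
have n2 : \forall v \near phi1 a, U1 (psi1 v).
  by apply: cpsi1; rewrite psi1a; exact: open_nbhs_nbhs.
have n3 : \forall v \near phi1 a, U2 (psi1 v).
  by apply: cpsi1; rewrite psi1a; exact: open_nbhs_nbhs.
have n4 : \forall v \near phi1 a, rnorm (psi1 v - a) < c.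
  apply: (cpsi1 [set z | rnorm (z - a) < c]); apply/nbhs_rnormP; exists c => // y.
  by rewrite psi1a.
have wu : \forall v \near phi1 a, (w \o u) v = v.
  have near_all := [elaborate filterI (filterI n1 n2) (filterI n3 n4)].
  refine (@filterS _ (nbhs (phi1 a)) _ _ _ _ near_all) => v [[v1 v2] [v3 v4]].
  have [z A1z zv] := surj1 v v1.
  have psi1v : psi1 v = z by rewrite -zv; apply: can1; rewrite inE.
  have A2z : (coefvec m @` (S `&` Om2)) z.
    have [q [Sq O1q] qz] := A1z; exists q => //; split=> //.
    by apply: cP; [exact: Sm|rewrite qz -psi1v].
  rewrite psi1v in v2 v3.
  have -> : (w \o u) v = Phi1 (psi2 (Phi2 z)) by rewrite /= /w /u /= psi1v.
  have -> : Phi2 z = phi2 z by apply: e2; rewrite inE.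
  have -> : psi2 (phi2 z) = z by apply: can2; rewrite inE.
  by rewrite -[RHS]zv; apply: e1; rewrite inE.
have dwu := has_deriv_comp dA dB.
have did : has_deriv (w \o u) (phi1 a) 1%:M.
  apply: (@has_deriv_near _ _ _ id).
    by refine (@filterS _ (nbhs (phi1 a)) _ _ _ _ wu) => v ->.
  move=> e e0; exists 1 => // y _.
  by rewrite mulmx1 subrr rnorm0 mulr_ge0 ?rnorm_ge0// ltW.
exact: mulmx1_min (has_deriv_unique dwu did).
Qed.

Lemma manifold_dimE m S p d : S p -> analytic_manifold_of_dim m S d ->
  manifold_dim m S = d.
Proof.
move=> Sp hd; have [Sm ch] := hd.
have hx : analytic_manifold_of_dim m S (manifold_dim m S).
  by apply: (@xgetPex _ 0%N (analytic_manifold_of_dim m S)); exists d.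
have [_ ch'] := hx.
by apply/eqP; rewrite eqn_leq (chart_dim_le Sm Sp (ch' p Sp) (ch p Sp))
  (chart_dim_le Sm Sp (ch p Sp) (ch' p Sp)).
Qed.

End Charts.

Section SliceChart.
Variables (R : realType) (l r : nat).
Local Notation C := (C R).
Variables (md : 'I_r -> multinom l) (k : 'I_r -> nat) (m : multinom l).
Hypothesis k0 : forall j, (0 < k j)%N.
Hypothesis mE : forall i, m i = (\sum_j k j * md j i)%N.

(** The inverse of the chart is [slice_product], restricted to a ball on which it has
    a holomorphic left inverse and takes regular values; the neighbourhood [Omega]
    is so small that these are the only points of the set in it. *)
Lemma slice_chart (i0 : forall j, 'I_(dimP (md j))) (x0 : 'rV[C]_(slice_dim i0)) :
  slice_regular x0 ->
  exists Omega (V : set 'rV[C]_(slice_dim i0))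
      (phi : 'rV[C]_(dimP m) -> 'rV[C]_(slice_dim i0)),
    [/\ open_in_polys m Omega, Omega (slice_product k x0), open V &
        biholomorphic (coefvec m @` (fact_set C m md k `&` Omega)) V phi].
Proof.
move=> gx; have [x00 ex irr cop] := gx.
pose psi := coefvec m \o slice_product (R := R) k (i0 := i0).
have [A dA freeA] := slice_immersion k0 mE x00 ex irr cop.
have dpsi x : exists B, has_deriv psi x B.
  have [B dB _] := dual_deriv_strict (slice_product_deriv k x) (slice_product_in k0 mE).
  by exists B; exact: strict_deriv_has_deriv.
have [Phi [d1 [d2 [d10 d20 dPhi PhiK]]]] := immersion_left_inverse dA freeA dpsi.
have /nbhs_rnormP[d3 d30 d3P] := near_slice_regular gx.
pose c1 := Num.min d1 d3.
have c10 : 0 < c1 by rewrite lt_min d10.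
pose U := [set x : 'rV[C]_(slice_dim i0) | rnorm (x - x0) < c1].
have UP x : U x -> [/\ slice_regular x, rnorm (psi x - psi x0) < d2 & Phi (psi x) = x].
  by rewrite /U /= lt_min => /andP[/PhiK[xd xK] /d3P].
have nU : nbhs x0 U by apply/nbhs_rnormP; exists c1.
have /nbhs_rnormP[d4 d40 d4P] := slice_captures k0 mE gx nU.
pose c2 := Num.min d2 d4.
have c20 : 0 < c2 by rewrite lt_min d20.
pose f0 := slice_product k x0.
pose Omega : set (mpoly l C) := [set q | in_polys m q /\ rnorm (coefvec m q - coefvec m f0) < c2].
have f0m : in_polys m f0 by exact: slice_product_in.
pose V := [set x | U x /\ rnorm (psi x - psi x0) < c2].
have open_ball (n : nat) (v : 'rV[C]_n) (c : R) : open [set w | rnorm (w - v) < c].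
  rewrite openE => w wc; apply/nbhs_rnormP; exists (c - rnorm (w - v)).
    by rewrite subr_gt0.
  by move=> y yw; apply: le_lt_trans (rnorm_tri y w v) _; rewrite -ltrBrDr.
have cpsi : continuous psi.
  by move=> x; have [B dB] := dpsi x; exact: has_deriv_continuous dB.
have oV : open V.
  apply: openI; first exact: open_ball.
  apply: (open_comp (D := [set w | rnorm (w - psi x0) < c2])) => //.
have AE v : (coefvec m @` (fact_set C m md k `&` Omega)) v <-> exists2 x, V x & psi x = v.
  split=> [[q [Sq [qm qc]] <-]|[x [Ux xc] <-]].
    have [_ q4] : rnorm (coefvec m q - coefvec m f0) < d2 /\ rnorm (coefvec m q - coefvec m f0) < d4.
      by move: qc; rewrite lt_min => /andP.
    have [x Ux ex'] := d4P _ q4 q Sq erefl.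
    exists x; last by rewrite /psi /= ex'.
    by split=> //; rewrite /psi /= ex'.
  have [gx' _ _] := UP x Ux; exists (slice_product k x); last exact: erefl.
  split; first exact: (slice_regular_fact_set mE gx').
  split; [exact: (slice_product_in k0 mE)|exact: xc].
exists Omega, V, Phi; split; [exact: open_coefvec_ball| |exact: oV|].
  by split; [exact: f0m|rewrite subrr rnorm0].
split.
- split.
  + by move=> v /AE[x Vx <-]; have [_ _ ->] := UP x Vx.1.
  + move=> v w; rewrite !inE => /AE[x Vx <-] /AE[y Vy <-].
    have [_ _ xK] := UP x Vx.1; have [_ _ yK] := UP y Vy.1.
    move=> e; exact: (congr1 psi (etrans (esym xK) (etrans e yK))).
  + move=> x Vx; have [_ _ xK] := UP x Vx.1; exists (psi x); last exact: xK.
    apply/AE; exists x; [exact: Vx|exact: erefl].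
- move=> v /AE[x Vx <-]; have [_ xd _] := UP x Vx.1.
  exists [set z | rnorm (z - psi x0) < d2], Phi; split; [exact: xd| |by []].
  split; [exact: open_ball|exact: dPhi].
exists psi; split; last first.
  move=> v; rewrite inE => /AE[x Vx <-]; have [_ _ xK] := UP x Vx.1.
  by rewrite xK.
split; first exact: oV.
move=> x _; apply/differentiable_rnormP; exact: dpsi.
Qed.

End SliceChart.

Theorem theorem3p6 (R : realType) (l r : nat) (m : multinom l)
    (md : 'I_r -> multinom l) (k : 'I_r -> nat)
    (hM : fact_structure (C R) m md k) :
  analytic_manifold m (fact_set (C R) m md k) /\
  codim m (fact_set (C R) m md k) =
    (dimP m)%:Z - ((\sum_(j < r) (dimP (md j))%:Z) + 1 - r%:Z).
Proof.
have [f [[f0 df] [c [g [c0 irr cop kg ef]]]]] := hM.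
have k0 j : (0 < k j)%N by case: (kg j).
have g0 j : g j != 0 by case: (irr j).
have mE i : m i = (\sum_j k j * md j i)%N.
  rewrite -df ef multideg_prod_exp//; apply: eq_bigr => j _.
  by rewrite (kg j).2.
have Sf : fact_set (C R) m md k f.
  split=> //; exists c, g; split=> // j; split=> //; exact: (kg j).2.
have [i0 [x0 [gx0 _]]] := normalized_factorization Sf.
have manif : analytic_manifold_of_dim m (fact_set (C R) m md k) (slice_dim i0).
  split=> [h [[_ dh] _]|h Sh]; first by rewrite /in_polys dh; apply/mpoly.mnm_lepP.
  have [i1 [x1 [gx1 <-]]] := normalized_factorization Sh.
  have -> : slice_dim i0 = slice_dim i1.
    by apply/eqP; rewrite -eqz_nat !slice_dimE.
  exact: slice_chart.
split; first by exists (slice_dim i0).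
by rewrite /codim (manifold_dimE Sf manif) slice_dimE.
Qed.
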